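(* Let $(E,\|\cdot\|_E)$ be a real Banach space of Rademacher type $p\in[1,2]$. Let $q\in[p,\infty)$, $k,M\in\mathbb{N}$ and let $\xi_1,\ldots,\xi_M\in L_{kq}(\Omega;E)$ be independent and identically distributed $E$-valued random variables. Then $$\Bigl\| \mathbb{M}^k_\varepsilon[\xi_1]-\frac1M\sum_{j=1}^M \otimes^k\xi_j\Bigr\|_{L_q(\Omega;\otimes^{k,s}_{\varepsilon_s}E)}\le C^{\mathsf{SL}}_{q,p,k}\,M^{-\left(1-\frac1p\right)}\,\|\xi_1\|_{L_{kq}(\Omega;E)}^k,$$ where $C^{\mathsf{SL}}_{q,p,k}:=2\bigl(2kK_{q,p}\tau_p(E)+B_q\bigr)$.
   Context: $(\Omega,\mathcal{A},\mathbb{P})$ is a complete probability space with expectation $\mathbb{E}$. For a real Banach space $F$ and $q\in[1,\infty)$, $L_q(\Omega;F)$ is the space of (classes of) Bochner measurable $\eta\colon\Omega\to F$ with $\|\eta\|_{L_q(\Omega;F)}:=(\mathbb{E}[\|\eta\|_F^q])^{1/q}<\infty$. $E'$ is the dual of $E$ and $B_{E'}$ its closed unit ball. Tensor products: $\otimes^kE$ is the $k$-fold algebraic tensor product, $\otimes^k x:=x\otimes\cdots\otimes x$ ($k$ times), and $\otimes^{k,s}E$ is the symmetric $k$-fold algebraic tensor product, i.e. the set of finite sums $U=\sum_{j=1}^M\lambda_j\otimes^kx_j$ with $\lambda_j\in\mathbb{R}$, $x_j\in E$. The injective norm of $U=\sum_{j} x_{j,1}\otimes\cdots\otimes x_{j,k}\in\otimes^kE$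 is $\|U\|_\varepsilon:=\sup\{|\sum_j\prod_{n=1}^kf_n(x_{j,n})|: f_1,\ldots,f_k\in B_{E'}\}$; the symmetric injective norm of $U=\sum_j\lambda_j\otimes^kx_j\in\otimes^{k,s}E$ is $\|U\|_{\varepsilon_s}:=\sup\{|\sum_j\lambda_jf(x_j)^k|: f\in B_{E'}\}$. $\otimes^k_\varepsilon E$ and $\otimes^{k,s}_{\varepsilon_s}E$ are the completions of $\otimes^kE$ and $\otimes^{k,s}E$ in these norms; the two norms are equivalent on symmetric tensors. For $\xi\in L_k(\Omega;E)$ the injective $k$th moment is the Bochner integral $\mathbb{M}^k_\varepsilon[\xi]:=\mathbb{E}[\otimes^k\xi]$ in $\otimes^k_\varepsilon E$; it belongs to $\otimes^{k,s}_{\varepsilon_s}E$. Constants: a Rademacher family is a family of independent random variables $r_j$ with values in $\{-1,1\}$, each value having probability $\tfrac12$, on a complete probability space $(\widetilde\Omega,\widetilde{\mathcal A},\widetilde{\mathbb P})$. $K_{q,p}$ (Kahane--Khintchine constant, $p,q\in[1,\infty)$) is the smallest $K\in(0,\infty)$ with $\|\sum_{j=1}^nr_jx_j\|_{L_q(\widetilde\Omega;F)}\le K\|\sum_{j=1}^nr_jx_j\|_{L_p(\widetilde\Omega;F)}$ for all Rademacher families, all real Banach spaces $F$, all $n$ and all $x_j\in F$. $F$ has Rademacher type $p\in[1,2]$ if there is $\tau\in(0,\infty)$ with $\|\sum_{j=1}^nr_jx_j\|_{L_p(\widetilde\Omega;F)}\le\tau(\sum_{j=1}^n\|x_j\|_F^p)^{1/p}$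 for all Rademacher families, all $n$ and all $x_j\in F$; the smallest such $\tau$ is $\tau_p(F)$. $B_q\in(0,\infty)$ is a constant depending only on $q$ for which the classical Khintchine inequality $\|\sum_{j=1}^nr_ja_j\|_{L_q(\widetilde\Omega;\mathbb{R})}\le B_q(\sum_{j=1}^na_j^2)^{1/2}$ holds for all finite real sequences $(a_j)$ and all Rademacher families. *)

(* Defs.v *)
From HB Require Import structures.
From mathcomp Require Import all_boot all_order all_algebra.
From mathcomp Require Import all_classical all_reals all_analysis.

Set Implicit Arguments.
Unset Strict Implicit.
Unset Printing Implicit Defensive.

Import Order.TTheory GRing.Theory Num.Theory.
Import numFieldNormedType.Exports.

Local Open Scope classical_set_scope.
Local Open Scope ring_scope.

(** An element of L_q(Omega; F) is represented by a function Omega -> F; all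
    the notions below are invariant under almost sure equality when the
    probability space is complete. *)

Section Bochner.
Context {R : realType} {d : measure_display} {T : measurableType d}.
Variable P : probability T R.
Context {F : normedModType R}.
Implicit Types (s eta : T -> F).

Definition simple_function s : Prop :=
  finite_set (range s) /\ forall y, measurable (s @^-1` [set y]).

Definition simple_expectation s : F :=
  \sum_(y \in range s) (fine (P (s @^-1` [set y])) *: y).

Definition bochner_measurable eta : Prop :=
  exists s : nat -> T -> F, (forall n, simple_function (s n)) /\
    {ae P, forall w, s n w @[n --> \oo] --> eta w}.

Definition is_bochner_expectation eta (v : F) : Prop :=
  exists s : nat -> T -> F,
    [/\ forall n, simple_function (s n),
        {ae P, forall w, s n w @[n --> \oo] --> eta w},
        (\int[P]_w (`|eta w - s n w|)%:E)%E @[n --> \oo] --> 0%E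
      & simple_expectation (s n) @[n --> \oo] --> v].

(** 0 if [eta] is not Bochner integrable. *)
Definition bochner_expectation eta : F := xget 0 (is_bochner_expectation eta).

(** ||eta||_{L_q(Omega; F)}, with values in [0, +oo]. *)
Definition Lqnorm (q : R) eta : \bar R :=
  Lnorm P q%:E (fun w => (`|eta w|)%:E).

Definition in_Lq (q : R) eta : Prop :=
  bochner_measurable eta /\ (Lqnorm q eta < +oo)%E.

End Bochner.

Section Independence.
Context {R : realType} {d : measure_display} {T : measurableType d}.
Variable P : probability T R.
Context {V : topologicalType}.

Definition borel : set (set V) := <<s [set A : set V | open A] >>.

Definition independent (I : finType) (X : I -> T -> V) : Prop :=
  forall (J : {set I}) (B : I -> set V), (forall i, borel (B i)) ->
    P (\big[setI/setT]_(i in J) (X i @^-1` B i)) =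
    (\prod_(i in J) P (X i @^-1` B i))%E.

Definition identically_distributed (I : finType) (X : I -> T -> V) : Prop :=
  forall (i j : I) (B : set V), borel B -> P (X i @^-1` B) = P (X j @^-1` B).

End Independence.

Section Rademacher.
Context {R : realType}.

Definition rademacher_family {d : measure_display} {T : measurableType d}
    (P : probability T R) (I : finType) (r : I -> T -> R) : Prop :=
  [/\ forall i, measurable_fun setT (r i),
      forall i w, r i w = 1 \/ r i w = -1,
      forall i, P (r i @^-1` [set 1]) = (2^-1)%:E /\
                P (r i @^-1` [set -1]) = (2^-1)%:E
    & independent P r].

Definition rademacher_sum {T : Type} {F : normedModType R} (n : nat)
    (r : 'I_n -> T -> R) (x : 'I_n -> F) : T -> F :=
  fun w => \sum_(j < n) r j w *: x j.

Definition kahane_khintchine_bound (q p K : R) : Prop :=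
  forall (d : measure_display) (T : measurableType d) (P : probability T R),
  measure_is_complete P ->
  forall (F : completeNormedModType R) (n : nat)
    (r : 'I_n -> T -> R) (x : 'I_n -> F), rademacher_family P r ->
  (Lqnorm P q (rademacher_sum r x)
     <= K%:E * Lqnorm P p (rademacher_sum r x))%E.

(** K_{q,p}. The infimum is taken in [0, +oo], where it would be
    +oo if no real bound existed; it is finite and attained by the
    Kahane-Khintchine inequality. *)
Definition kahane_khintchine (q p : R) : \bar R :=
  ereal_inf [set K%:E | K in [set K : R | 0 < K /\
                                kahane_khintchine_bound q p K]].

Definition type_bound (F : completeNormedModType R) (p tau : R) : Prop :=
  forall (d : measure_display) (T : measurableType d) (P : probability T R),
  measure_is_complete P ->
  forall (n : nat) (r : 'I_n -> T -> R) (x : 'I_n -> F),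
  rademacher_family P r ->
  (Lqnorm P p (rademacher_sum r x)
     <= (tau * (\sum_(j < n) `|x j| `^ p) `^ p^-1)%:E)%E.

Definition rademacher_type (F : completeNormedModType R) (p : R) : Prop :=
  exists tau : R, 0 < tau /\ type_bound F p tau.

(** tau_p(F). The infimum is attained unless F = {0}, where every positive
    real is admissible and the infimum is 0. *)
Definition type_constant (F : completeNormedModType R) (p : R) : \bar R :=
  ereal_inf [set tau%:E | tau in [set tau : R | 0 < tau /\
                                    type_bound F p tau]].

(** [B] can serve as B_q. *)
Definition khintchine_bound (q B : R) : Prop :=
  forall (d : measure_display) (T : measurableType d) (P : probability T R),
  measure_is_complete P ->
  forall (n : nat) (r : 'I_n -> T -> R) (a : 'I_n -> R^o),
  rademacher_family P r ->
  (Lqnorm P q (rademacher_sum r a)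
     <= (B * Num.sqrt (\sum_(j < n) a j ^+ 2))%:E)%E.

End Rademacher.

(** The algebraic tensor power of E is realised in the linear dual of the
    k-linear forms on E: x_1 (x) ... (x) x_k is evaluation at (x_1, ..., x_k),
    and the tensors are the linear combinations of these evaluations. No relation
    is added or lost, since k-linear forms separate the algebraic tensors; the
    injective norm evaluates a tensor at the forms f_1 (x) ... (x) f_k. *)

Section Multilinear.
Context {R : realType} (k : nat) (E : normedModType R).

Definition replace_at (x : 'I_k -> E) (i : 'I_k) (u : E) : 'I_k -> E :=
  fun n => if n == i then u else x n.

Definition multilinear (A : ('I_k -> E) -> R) : Prop :=
  forall (i : 'I_k) (x : 'I_k -> E) (a : R) (u v : E),
    A (replace_at x i (a *: u + v)) =
    a * A (replace_at x i u) + A (replace_at x i v).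

Record mlform := MLForm {
  mlform_fun :> ('I_k -> E) -> R;
  mlform_prop : multilinear mlform_fun }.

Lemma prod_form_multilinear (f : 'I_k -> {scalar E}) :
  multilinear (fun x => \prod_(n < k) f n (x n)).
Proof.
move=> i x a u v.
have e w : \prod_(n < k) f n (replace_at x i w n) =
           f i w * \prod_(n < k | n != i) f n (x n).
  rewrite (bigD1 i) //= /replace_at eqxx; congr (_ * _).
  by apply: eq_bigr => n ni; rewrite (negbTE ni).
by rewrite !e linearP mulrDl mulrA.
Qed.

Definition prod_form (f : 'I_k -> {scalar E}) : mlform :=
  MLForm (prod_form_multilinear f).

Definition elementary (x : 'I_k -> E) : mlform -> R^o := fun A => A x.

Definition is_tensor : {pred mlform -> R^o} := fun U =>
  `[< exists (n : nat) (lam : 'I_n -> R) (x : 'I_n -> 'I_k -> E),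
        U = \sum_(j < n) lam j *: elementary (x j) >].

Definition is_sym_tensor : {pred mlform -> R^o} := fun U =>
  `[< exists (n : nat) (lam : 'I_n -> R) (x : 'I_n -> E),
        U = \sum_(j < n) lam j *: elementary (fun=> x j) >].

End Multilinear.

Section SpanClosed.
Context {R : realType} {V : lmodType R} {X : Type} (e : X -> V).

Lemma span_closed (Q : {pred V}) :
  (forall U, U \in Q <-> exists (n : nat) (lam : 'I_n -> R) (x : 'I_n -> X),
                         U = \sum_(j < n) lam j *: e (x j)) ->
  submod_closed Q.
Proof.
move=> QE; split.
  by apply/QE; exists 0%N, (fun=> 0), (fun i : 'I_0 => match notF (ltn_ord i) with end); rewrite big_ord0.
move=> a u v /QE[n [l [x ->]]] /QE[m [l' [y ->]]]; apply/QE.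
exists (n + m)%N.
exists (fun i => match fintype.split i with inl j => a * l j | inr j => l' j end).
exists (fun i => match fintype.split i with inl j => x j | inr j => y j end).
rewrite big_split_ord /= scaler_sumr; congr (_ + _).
  by apply: eq_bigr => i _; rewrite (unsplitK (inl i)) scalerA.
by apply: eq_bigr => i _; rewrite (unsplitK (inr i)).
Qed.

End SpanClosed.

Section Tensors.
Context {R : realType} (k : nat) (E : normedModType R).

Lemma is_tensor_closed : submod_closed (@is_tensor R k E).
Proof. by apply: (@span_closed _ _ _ (@elementary R k E)) => U;
  split=> /asboolP. Qed.

Lemma is_sym_tensor_closed : submod_closed (@is_sym_tensor R k E).
Proof. by apply: (@span_closed _ _ _ (fun x => @elementary R k E (fun=> x)))
  => U; split=> /asboolP. Qed.

HB.instance Definition _ :=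
  GRing.isSubmodClosed.Build R _ (@is_tensor R k E) is_tensor_closed.
HB.instance Definition _ :=
  GRing.isSubmodClosed.Build R _ (@is_sym_tensor R k E) is_sym_tensor_closed.

Record tensor := Tensor {
  tensor_val :> mlform k E -> R^o;
  tensor_prop : tensor_val \in @is_tensor R k E }.
HB.instance Definition _ := [isSub for tensor_val].
HB.instance Definition _ := [Choice of tensor by <:].
HB.instance Definition _ := [SubChoice_isSubLmodule of tensor by <:].

Record sym_tensor := SymTensor {
  sym_tensor_val :> mlform k E -> R^o;
  sym_tensor_prop : sym_tensor_val \in @is_sym_tensor R k E }.
HB.instance Definition _ := [isSub for sym_tensor_val].
HB.instance Definition _ := [Choice of sym_tensor by <:].
HB.instance Definition _ := [SubChoice_isSubLmodule of sym_tensor by <:].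

Lemma sym_tensor_is_tensor (U : sym_tensor) :
  (U : mlform k E -> R^o) \in @is_tensor R k E.
Proof.
case: U => U /= /asboolP[n [l [x ->]]].
by apply/asboolP; exists n, l, (fun j _ => x j).
Qed.

Definition tensor_of_sym (U : sym_tensor) : tensor :=
  Tensor (sym_tensor_is_tensor U).

Lemma elementary_sym (x : E) :
  elementary (fun=> x) \in @is_sym_tensor R k E.
Proof.
by apply/asboolP; exists 1%N, (fun=> 1), (fun=> x); rewrite big_ord1 scale1r.
Qed.

Definition sym_tpow (x : E) : sym_tensor := SymTensor (elementary_sym x).
Definition tpow (x : E) : tensor := tensor_of_sym (sym_tpow x).

(** The bound forces continuity, so this is the closed unit ball of the
    topological dual. *)
Definition dual_ball : set {scalar E} :=
  [set f | forall x : E, `|f x| <= `|x|].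

Definition inj_norm (U : tensor) : R :=
  sup [set `|U (prod_form f)| | f in
         [set f : 'I_k -> {scalar E} | forall n, dual_ball (f n)]].

Definition sym_inj_norm (U : sym_tensor) : R :=
  sup [set `|U (prod_form (fun=> f))| | f in dual_ball].

Lemma elementary_sumE (n : nat) (l : 'I_n -> R) (x : 'I_n -> 'I_k -> E)
    (A : mlform k E) :
  (\sum_(j < n) l j *: elementary (x j)) A = \sum_(j < n) l j * A (x j).
Proof.
by elim/big_rec2: _ => // j a U _ <-.
Qed.

Lemma inj_normE (U : tensor) (n : nat) (l : 'I_n -> R)
    (x : 'I_n -> 'I_k -> E) :
  (U : mlform k E -> R^o) = \sum_(j < n) l j *: elementary (x j) ->
  inj_norm U = sup [set `|\sum_(j < n) l j * \prod_(m < k) f m (x j m)| | f in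
         [set f : 'I_k -> {scalar E} | forall m, dual_ball (f m)]].
Proof.
by move=> UE; congr sup; apply: eq_imagel => f _; rewrite UE elementary_sumE.
Qed.

Lemma sym_inj_normE (U : sym_tensor) (n : nat) (l : 'I_n -> R)
    (x : 'I_n -> E) :
  (U : mlform k E -> R^o) = \sum_(j < n) l j *: elementary (fun=> x j) ->
  sym_inj_norm U =
    sup [set `|\sum_(j < n) l j * f (x j) ^+ k| | f in dual_ball].
Proof.
move=> UE; congr sup; apply: eq_imagel => f _; rewrite UE elementary_sumE.
congr `|_|; apply: eq_bigr => j _ /=.
by rewrite prodr_const card_ord.
Qed.

End Tensors.

(** [i : V -> S] exhibits the Banach space [S] as the completion of the vector
    space [V] in the norm [N] (unique up to isometric isomorphism). *)
Definition is_completion {R : realType} {V : lmodType R} (N : V -> R)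
    (S : completeNormedModType R) (i : {linear V -> S}) : Prop :=
  (forall U, `|i U| = N U) /\ dense (range i).

Section Completions.
Context {R : realType} {k : nat} {E : normedModType R}.
Context {T S : completeNormedModType R}.
Variables (iT : {linear tensor k E -> T}) (iS : {linear sym_tensor k E -> S}).

(** Identification of the completed symmetric tensors [S] with a subspace of the
    completed tensors [T], extending by continuity the inclusion of the symmetric
    tensors: [m] is identified with [z] iff some sequence of symmetric tensors
    converges to [m] in [S] and to [z] in [T]. *)
Definition sym_identified (m : S) (z : T) : Prop :=
  exists U : nat -> sym_tensor k E,
    iS (U n) @[n --> \oo] --> m /\ iT (tensor_of_sym (U n)) @[n --> \oo] --> z.

Definition injective_moment {d : measure_display} {Omega : measurableType d}
    (P : probability Omega R) (xi : Omega -> E) : T :=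
  bochner_expectation P (fun w => iT (tpow k (xi w))).

End Completions.

Definition slln_constant {R : realType} (E : completeNormedModType R)
    (q p : R) (k : nat) (B : R) : \bar R :=
  (2%:E * ((2 * k%:R)%:E * kahane_khintchine q p * type_constant E p + B%:E))%E.

(* Main.v *)
Require Import Defs.
From HB Require Import structures.
From mathcomp Require Import all_boot all_order all_algebra.
From mathcomp Require Import all_classical all_reals all_analysis.
From mathcomp Require Import finmap measurable_realfun.
From mathcomp Require Import ring lra.

(** The proof reduces everything to finite sums and then combines
    symmetrization, the contraction principle and the type of E.

    Finitely valued samples. Suppose that the xi_j take finitely many values x_c,
    with probabilities w_c, and write g(c) for the power of x_c in the symmetric
    injective tensor product S. The law of the sample is the product weight, and
    [symmetrization] bounds the q-th moment of the sum of the centred powers by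
    2^q times the one of the Rademacher sum of the g(c_j). For fixed vectors x_j,
    the norm of that Rademacher sum in S is the supremum over the dual ball of
    |sum_j e_j f(x_j)^k|. The map t |-> t^k has Lipschitz constant k |x_j|^(k-1)
    on the interval where f(x_j) lives, so the contraction principle
    [rademacher_contraction] replaces f(x_j)^k by k |x_j|^(k-1) f(x_j), at the
    price of a factor 2 for the absolute value inside the supremum: this is
    [rademacher_tpow]. What remains is a Rademacher sum in E itself, of the
    vectors |x_j|^(k-1) x_j, to which the Kahane-Khintchine inequality and the
    type of E apply. A power mean inequality turns the sum of the |x_j|^(kp) into
    the sum of the |x_j|^(kq), and [finite_slln] collects the constants: the
    factor is 4 k kappa M^(-(1 - 1/p)), where kappa is any constant of the
    combined Kahane-Khintchine and type inequality for M vectors of E.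

    General samples. Each xi_j is replaced by the nearest point of a finite set
    of values of simple functions that approximate all of the xi_j. Which point
    is nearest is a Borel function of xi_j, so the discretized variables are
    again independent and identically distributed, and 0 is among the points, so
    that they are dominated by 2 |xi_j|. By dominated convergence the means of the
    discretized powers converge in both completions, in the tensor product T to
    the injective moment and in S to the element m identified with it. Fatou's
    lemma for the error and dominated convergence for the moment of order kq then
    give the inequality with the constant kappa.

    Constants. K_(q,p) and tau_p(E) are infima of admissible constants K and tau,
    and kappa = K tau is admissible for each such pair. The infima are taken only
    at the end, in [slln_constant_bound], where K_(q,p) = +oo, tau_p(E) = 0 and a
    vanishing moment of xi_1 are settled separately. The resulting constant
    4 k K_(q,p) tau_p(E) is at most 2 (2 k K_(q,p) tau_p(E) + B_q). *)

Set Implicit Arguments.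
Unset Strict Implicit.
Unset Printing Implicit Defensive.

Import Order.TTheory GRing.Theory Num.Theory.
Import numFieldNormedType.Exports.

Local Open Scope classical_set_scope.
Local Open Scope ring_scope.

(** * Convexity of real powers *)

Section ConvexPower.
Context {R : realType}.
Implicit Types (r x y : R).

(** The graph of a convex power lies above its tangent at c; this is Young's
    inequality for y and c^(r-1). *)
Lemma powR_tangent r c y : 1 <= r -> 0 < c -> 0 <= y ->
  c `^ r + r * c `^ (r - 1) * (y - c) <= y `^ r.
Proof.
move=> r1 c0 y0; have r0 : 0 < r by apply: lt_le_trans r1.
have ccr : c * c `^ (r - 1) = c `^ r by rewrite mulr_powRB1// ltW.
have [r1E|rn1] := eqVneq r 1.
  by rewrite r1E subrr powRr0 !mulr1 !powRr1 ?(ltW c0)//; lra.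
have s0 : 0 < r - 1 by rewrite subr_gt0 lt_neqAle eq_sym rn1.
have := @conjugate_powR R y (c `^ (r - 1)) r (r / (r - 1)) y0 (powR_ge0 _ _) r0.
have q0 : 0 < r / (r - 1) by rewrite divr_gt0.
have conj1 : r^-1 + (r / (r - 1))^-1 = 1.
  by rewrite invf_div; field; rewrite !gt_eqF// subr_gt0.
move=> /(_ q0 conj1); rewrite -powRrM.
have -> : (r - 1) * (r / (r - 1)) = r by field; rewrite gt_eqF// subr_gt0.
move=> H.
have {}H : r * (y * c `^ (r - 1)) <= y `^ r + (r - 1) * c `^ r.
  have -> : y `^ r + (r - 1) * c `^ r =
      r * (y `^ r / r + c `^ r / (r / (r - 1))).
    by field; rewrite !gt_eqF// subr_gt0.
  by rewrite ler_pM2l.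
have -> : r * c `^ (r - 1) * (y - c) =
   r * (y * c `^ (r - 1)) - r * (c * c `^ (r - 1)) by ring.
rewrite ccr; lra.
Qed.

(** Integrate the tangent inequality at the mean c of the y_i: the linear term
    averages to zero. *)
Lemma powR_jensen (I : finType) (w y : I -> R) r : 1 <= r ->
  (forall i, 0 <= w i) -> \sum_i w i = 1 -> (forall i, 0 <= y i) ->
  (\sum_i w i * y i) `^ r <= \sum_i w i * y i `^ r.
Proof.
move=> r1 w0 w1 y0; set c := \sum_i _.
have c0 : 0 <= c by apply: sumr_ge0 => i _; rewrite mulr_ge0.
have cS : \sum_i w i * y i = c by [].
clearbody c.
have [cE|cn0] := eqVneq c 0.
  rewrite cE powR0; last by rewrite gt_eqF// (lt_le_trans _ r1).
  by apply: sumr_ge0 => i _; rewrite mulr_ge0// powR_ge0.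
have {}c0 : 0 < c by rewrite lt_neqAle eq_sym cn0.
apply: (@le_trans _ _ (\sum_i w i * (c `^ r + r * c `^ (r - 1) * (y i - c)))).
  have -> : \sum_i w i * (c `^ r + r * c `^ (r - 1) * (y i - c)) =
     (\sum_i w i) * (c `^ r - r * c `^ (r - 1) * c) +
     r * c `^ (r - 1) * (\sum_i w i * y i).
    rewrite mulr_suml mulr_sumr -big_split/=; apply: eq_bigr => i _; ring.
  by rewrite w1 cS le_eqVlt; apply/orP; left; apply/eqP; ring.
by apply: ler_sum => i _; apply: ler_wpM2l => //; apply: powR_tangent.
Qed.

Lemma powR_jensenD r x y : 1 <= r -> 0 <= x -> 0 <= y ->
  (x + y) `^ r <= 2 `^ r / 2 * (x `^ r + y `^ r).
Proof.
move=> r1 x0 y0.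
have := @powR_jensen bool (fun=> 2^-1) (fun b => if b then x else y) r r1.
rewrite !big_bool/= => /(_ (fun=> _)) H.
have -> : x + y = 2 * (2^-1 * x + 2^-1 * y) by field.
rewrite powRM; [|by []|by rewrite addr_ge0// mulr_ge0// invr_ge0].
rewrite -mulrA ler_wpM2l ?powR_ge0//= mulrDr.
apply: H => //; [by field|by case].
Qed.

Lemma powR_sum_le (I : finType) (y : I -> R) r : 1 <= r -> (0 < #|I|)%N ->
  (forall i, 0 <= y i) ->
  (\sum_i y i) `^ r <= #|I|%:R `^ r / #|I|%:R * \sum_i y i `^ r.
Proof.
move=> r1 I0 y0; set N := #|I|%:R : R.
have N0 : 0 < N by rewrite ltr0n.
have := @powR_jensen I (fun=> N^-1) y r r1.
rewrite -!mulr_sumr => /(_ (fun=> _)) H.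
have -> : \sum_i y i = N * (N^-1 * \sum_i y i) by rewrite mulrA divff ?mul1r// gt_eqF.
rewrite powRM ?(ltW N0)//; last by rewrite mulr_ge0 ?invr_ge0 ?(ltW N0) ?sumr_ge0.
rewrite -mulrA ler_wpM2l ?powR_ge0//.
apply: H => //; first by rewrite invr_ge0 ltW.
by rewrite sumr_const -mulr_natr -/N mulVf// gt_eqF.
Qed.

(** Two-point case of the fact that a convex increasing function respects weak
    majorization. It lets the contraction principle be proved by comparing
    only the sum and the maximum of two suprema, without looking at
    maximizers. *)
Lemma powR_weak_majorization r (a b a' b' : R) : 1 <= r ->
  0 <= a -> 0 <= b -> 0 <= a' -> 0 <= b' ->
  a + b <= a' + b' -> Num.max a b <= Num.max a' b' ->
  a `^ r + b `^ r <= a' `^ r + b' `^ r.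
Proof.
move=> r1; have r0 : 0 <= r by apply: le_trans r1.
wlog ba : a b / b <= a.
  move=> H a0 b0 a'0 b'0 s m; case: (leP b a) => [ba|/ltW ab]; first exact: H.
  by rewrite addrC; apply: H => //; [rewrite addrC|rewrite maxC].
wlog ba' : a' b' / b' <= a'.
  move=> H a0 b0 a'0 b'0 s m; case: (leP b' a') => [ba'|/ltW ab'].
    exact: H.
  by rewrite [leRHS]addrC; apply: H => //; [rewrite (addrC b')|rewrite (maxC b')].
move=> a0 b0 a'0 b'0 s; rewrite (max_l ba) (max_l ba') => aa'.
case: (leP b b') => [bb'|b'b].
  by apply: lerD; apply: ge0_ler_powR.
(* a and b lie between c and b', which have the same sum, and c <= a' *)
set c := a + b - b'.
have cb' : 0 < c - b' by rewrite /c; lra.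
pose t := (a - b') / (c - b').
have t0 : 0 <= t by apply: divr_ge0; [lra|exact: ltW].
have t1 : t <= 1 by rewrite ler_pdivrMr// /c; lra.
have J x y u : 0 <= x -> 0 <= y -> 0 <= u -> u <= 1 ->
    (u * x + (1 - u) * y) `^ r <= u * x `^ r + (1 - u) * y `^ r.
  move=> x0 y0 u0 u1.
  have := @powR_jensen bool (fun b => if b then u else 1 - u)
    (fun b => if b then x else y) r r1.
  rewrite !big_bool/=; apply; [by case; lra|lra|by case].
have c0 : 0 <= c by rewrite /c; lra.
have aE : a = t * c + (1 - t) * b'.
  have -> : t * c + (1 - t) * b' = t * (c - b') + b' by ring.
  by rewrite /t divfK ?gt_eqF// subrK.
have bE : b = t * b' + (1 - t) * c.
  have -> : t * b' + (1 - t) * c = c - t * (c - b') by ring.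
  by rewrite /t divfK ?gt_eqF// /c; ring.
have H1 := J c b' t c0 b'0 t0 t1; have H2 := J b' c t b'0 c0 t0 t1.
rewrite -aE in H1; rewrite -bE in H2.
have ca' : c `^ r <= a' `^ r.
  by apply: ge0_ler_powR => //; rewrite /c; lra.
lra.
Qed.

End ConvexPower.

(** * Averages over signs *)

Definition signs (n : nat) := {ffun 'I_n -> bool}.

Section SignAverages.
Context {R : realType}.

Definition sign_at (n : nat) (e : signs n) (j : 'I_n) : R :=
  if e j then 1 else -1.

(** Expectation over n independent fair signs. *)
Definition sign_mean (n : nat) (Phi : signs n -> R) : R :=
  (2 ^+ n)^-1 * \sum_e Phi e.

Definition flip (n : nat) (J : pred 'I_n) (e : signs n) : signs n :=
  [ffun j => if J j then ~~ e j else e j].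

Lemma flipK n J : involutive (@flip n J).
Proof. by move=> e; apply/ffunP => j; rewrite !ffunE; case: (J j); rewrite ?negbK. Qed.

Lemma sign_at_flip n J (e : signs n) j :
  sign_at (flip J e) j = if J j then - sign_at e j else sign_at e j.
Proof. by rewrite /sign_at ffunE; case: (J j); case: (e j); rewrite //= opprK. Qed.

Lemma sign_mean_flip n J (Phi : signs n -> R) :
  sign_mean (fun e => Phi (flip J e)) = sign_mean Phi.
Proof.
rewrite /sign_mean; congr (_ * _).
by rewrite [RHS](reindex_inj (inv_inj (@flipK n J))).
Qed.

Lemma card_signs n : #|signs n| = (2 ^ n)%N.
Proof. by rewrite card_ffun card_bool card_ord. Qed.

Lemma ler_sign_mean n (Phi Psi : signs n -> R) :
  (forall e, Phi e <= Psi e) -> sign_mean Phi <= sign_mean Psi.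
Proof.
move=> H; rewrite ler_wpM2l ?invr_ge0 ?exprn_ge0//.
exact: ler_sum.
Qed.

Lemma sign_mean_ge0 n (Phi : signs n -> R) :
  (forall e, 0 <= Phi e) -> 0 <= sign_mean Phi.
Proof.
by move=> H; rewrite mulr_ge0 ?invr_ge0 ?exprn_ge0 ?sumr_ge0.
Qed.

Lemma sign_mean_cst n (c : R) : sign_mean (fun=> c : R) (n := n) = c.
Proof.
by rewrite /sign_mean sumr_const card_signs -(mulr_natl c) natrX mulKf.
Qed.

Lemma sign_meanD n (Phi Psi : signs n -> R) :
  sign_mean (fun e => Phi e + Psi e) = sign_mean Phi + sign_mean Psi.
Proof. by rewrite /sign_mean big_split/= mulrDr. Qed.

Lemma sign_meanZ n c (Phi : signs n -> R) :
  sign_mean (fun e => c * Phi e) = c * sign_mean Phi.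
Proof. by rewrite /sign_mean -mulr_sumr mulrCA. Qed.

End SignAverages.

(** * The contraction principle *)

Section Contraction.
Context {R : realType} {T : Type} (D : set T) (f0 : T).
Hypothesis Df0 : D f0.

Let S (h : T -> R) : R := sup [set h f | f in D].
Definition bounded_on (h : T -> R) := exists C, forall f, D f -> `|h f| <= C.

Let bnd_sup h : bounded_on h -> has_sup [set h f | f in D].
Proof.
move=> [C HC]; split; first by exists (h f0), f0.
by exists C => _ [f Df <-]; apply: le_trans (HC f Df); exact: ler_norm.
Qed.

Let le_S h f : bounded_on h -> D f -> h f <= S h.
Proof.
by move=> /bnd_sup[_ ub] Df; apply: (ub_le_sup ub); exists f.
Qed.

Let S_le h c : (forall f, D f -> h f <= c) -> S h <= c.
Proof.
move=> H; apply: ge_sup; first by exists (h f0), f0.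
by move=> _ [f Df <-]; exact: H.
Qed.

Let bndD h h' : bounded_on h -> bounded_on h' -> bounded_on (fun f => h f + h' f).
Proof.
move=> [C HC] [C' HC']; exists (C + C') => f Df.
by apply: (le_trans (ler_normD _ _)); apply: lerD; [exact: HC|exact: HC'].
Qed.

Let bndN h : bounded_on h -> bounded_on (fun f => - h f).
Proof. by move=> [C HC]; exists C => f Df; rewrite normrN; exact: HC. Qed.

(** One step of the contraction principle, for the coordinate whose sign is
    averaged. The sum of the two suprema is controlled by pairing points f and
    f': the increment of phi between them is at most the one of t, and
    exchanging f and f' gives t the favourable sign. Their maximum is
    controlled since phi is dominated by |t|. Weak majorization does the
    rest. *)
Lemma sup_contraction r (h phi t : T -> R) : 1 <= r ->
  bounded_on h -> bounded_on phi -> bounded_on t ->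
  h f0 = 0 -> phi f0 = 0 -> t f0 = 0 ->
  (forall f f', D f -> D f' -> `|phi f - phi f'| <= `|t f - t f'|) ->
  S (fun f => h f + phi f) `^ r + S (fun f => h f - phi f) `^ r <=
  S (fun f => h f + t f) `^ r + S (fun f => h f - t f) `^ r.
Proof.
move=> r1 bh bp bt h0 p0 t0 lip.
have bP := bndD bh bp; have bM := bndD bh (bndN bp).
have bP' := bndD bh bt; have bM' := bndD bh (bndN bt).
have le_t f : D f -> `|phi f| <= `|t f|.
  by move=> Df; have := lip f f0 Df Df0; rewrite p0 t0 !subr0.
have ge0 g : bounded_on g -> g f0 = 0 -> 0 <= S g.
  by move=> bg g0; rewrite -g0; exact: le_S.
apply: powR_weak_majorization => //;
  try by apply: ge0 => //; rewrite h0 ?p0 ?t0 ?subr0 ?addr0.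
- rewrite -lerBrDr; apply: S_le => f Df; rewrite lerBrDr addrC -lerBrDr.
  apply: S_le => f' Df'.
  have A1 := le_S bP' Df; have A2 := le_S bM' Df'.
  have A3 := le_S bP' Df'; have A4 := le_S bM' Df.
  have L := le_trans (ler_norm _) (lip f f' Df Df').
  case: (lerP 0 (t f - t f')) => [t_ge|t_lt].
    rewrite ger0_norm// in L; lra.
  rewrite ltr0_norm// in L; lra.
- rewrite ge_max; apply/andP; split; apply: S_le => f Df.
  + have A1 := le_S bP' Df; have A4 := le_S bM' Df.
    have L := le_trans (ler_norm _) (le_t f Df).
    rewrite le_max; case: (lerP 0 (t f)) => [t_ge|t_lt].
      rewrite ger0_norm// in L; apply/orP; left; lra.
    rewrite ltr0_norm// in L; apply/orP; right; lra.
  + have A1 := le_S bP' Df; have A4 := le_S bM' Df.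
    have L : - phi f <= `|t f|.
      by rewrite (le_trans _ (le_t f Df))// -normrN ler_norm.
    rewrite le_max; case: (lerP 0 (t f)) => [t_ge|t_lt].
      rewrite ger0_norm// in L; apply/orP; left; lra.
    rewrite ltr0_norm// in L; apply/orP; right; lra.
Qed.

(** One-sided: the contraction principle below compares suprema of the values
    themselves, not of their absolute values. *)
Definition rademacher_sup n (u : 'I_n -> T -> R) (e : signs n) : R :=
  S (fun f => \sum_j sign_at e j * u j f).

Lemma bounded_on_sum n (u : 'I_n -> T -> R) (P : pred 'I_n) (e : signs n) :
  (forall j, bounded_on (u j)) ->
  bounded_on (fun f => \sum_(j | P j) sign_at e j * u j f).
Proof.
move=> bu; have [C HC] := choice bu; exists (\sum_j C j) => f Df.
apply: (le_trans (ler_norm_sum _ _ _)).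
rewrite big_mkcond/=; apply: ler_sum => j _; case: ifP => _.
  rewrite normrM; have -> : `|sign_at e j| = 1 :> R.
    by rewrite /sign_at; case: (e j); rewrite ?normrN normr1.
  by rewrite mul1r; exact: HC.
exact: le_trans (HC j f Df).
Qed.

Lemma contraction_step n (u v : 'I_n -> T -> R) (i : 'I_n) r : 1 <= r ->
  (forall j, bounded_on (u j)) -> (forall j, bounded_on (v j)) ->
  (forall j, u j f0 = 0) -> (forall j, v j f0 = 0) ->
  (forall j, j != i -> u j = v j) ->
  (forall f f', D f -> D f' -> `|u i f - u i f'| <= `|v i f - v i f'|) ->
  \sum_e rademacher_sup u e `^ r <= \sum_e rademacher_sup v e `^ r.
Proof.
move=> r1 bu bv u0 v0 uv lip.
have split_i (w : 'I_n -> T -> R) : \sum_e rademacher_sup w e `^ r =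
   2^-1 * \sum_e (rademacher_sup w e `^ r + rademacher_sup w (flip (pred1 i) e) `^ r).
  rewrite big_split/= -(reindex_inj (inv_inj (@flipK n (pred1 i)))
    (P := xpredT) (F := fun e => rademacher_sup w e `^ r))/=; by field.
rewrite !split_i ler_wpM2l ?invr_ge0//; apply: ler_sum => e _.
pose h f := \sum_(j | j != i) sign_at e j * v j f : R.
have E (w : 'I_n -> T -> R) : (forall j, j != i -> w j = v j) ->
    (rademacher_sup w e = S (fun f => h f + sign_at e i * w i f)) *
    (rademacher_sup w (flip (pred1 i) e) = S (fun f => h f - sign_at e i * w i f)).
  move=> wv; split; congr sup; apply: eq_imagel => f _;
    rewrite (bigD1 i)//= addrC; congr (_ + _); rewrite ?sign_at_flip/= ?eqxx ?mulNr//.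
    by apply: eq_bigr => j ji; rewrite wv.
  by apply: eq_bigr => j ji; rewrite sign_at_flip/= (negbTE ji) wv.
have [-> ->] := E u uv; have [-> ->] := E v (fun _ _ => erefl).
have s1 x : `|sign_at e i * x| = `|x| :> R.
  by rewrite /sign_at; case: (e i); rewrite ?mul1r// mulN1r normrN.
apply: sup_contraction => //.
- exact: bounded_on_sum.
- by have [C HC] := bu i; exists C => f Df; rewrite s1; exact: HC.
- by have [C HC] := bv i; exists C => f Df; rewrite s1; exact: HC.
- by rewrite /h big1// => j _; rewrite v0 mulr0.
- by rewrite u0 mulr0.
- by rewrite v0 mulr0.
- by move=> f f' Df Df'; rewrite -!mulrBr !s1; exact: lip.
Qed.

(** The coordinates are exchanged one at a time; the intermediate family
    consists of v below m and of u from m on. *)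
Lemma rademacher_contraction n (u v : 'I_n -> T -> R) r : 1 <= r ->
  (forall j, bounded_on (u j)) -> (forall j, bounded_on (v j)) ->
  (forall j, u j f0 = 0) -> (forall j, v j f0 = 0) ->
  (forall j f f', D f -> D f' -> `|u j f - u j f'| <= `|v j f - v j f'|) ->
  sign_mean (fun e => rademacher_sup u e `^ r) <=
  sign_mean (fun e => rademacher_sup v e `^ r).
Proof.
move=> r1 bu bv u0 v0 lip; rewrite ler_wpM2l ?invr_ge0 ?exprn_ge0//.
pose w m (j : 'I_n) := if (j < m)%N then v j else u j.
have wn : w n = v by apply/funext => j; rewrite /w ltn_ord.
have w0 : w 0%N = u by apply/funext => j; rewrite /w ltn0.
suff H m : (m <= n)%N ->
    \sum_e rademacher_sup u e `^ r <= \sum_e rademacher_sup (w m) e `^ r.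
  by have := H n (leqnn n); rewrite wn.
elim: m => [_|m IH mn]; first by rewrite w0.
apply: (le_trans (IH (ltnW mn))).
apply: (@contraction_step _ _ _ (Ordinal mn)) => //;
  try by move=> j; rewrite /w; case: ifP.
- move=> j jm; rewrite /w ltnS (leq_eqVlt j).
  have /negbTE-> // : (j : nat) != m.
  by apply: contra_neq jm => jm; apply/val_inj.
- by move=> f f' Df Df'; rewrite /w/= ltnn leqnn; exact: lip.
Qed.

End Contraction.

(** * Injective norms of powers *)

Section TensorNorms.
Context {R : realType}.

(** Telescoping: change one factor at a time. *)
Lemma prod_diff_le (k : nat) (a b : 'I_k -> R) (rho delta : R) :
  0 <= delta ->
  (forall i, `|a i| <= rho) -> (forall i, `|b i| <= rho) ->
  (forall i, `|a i - b i| <= delta) ->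
  `|\prod_i a i - \prod_i b i| <= k%:R * rho ^+ k.-1 * delta.
Proof.
move=> d0; elim: k a b => [|k IH] a b ha hb hab.
  by rewrite !big_ord0 subrr normr0 !mul0r.
have rho0 : 0 <= rho by apply: le_trans (ha ord0).
rewrite !big_ord_recr/=.
set A := \prod_(i < k) a _; set B := \prod_(i < k) b _.
have -> : A * a ord_max - B * b ord_max =
  A * (a ord_max - b ord_max) + (A - B) * b ord_max by ring.
apply: (le_trans (ler_normD _ _)); rewrite !normrM.
have hA : `|A| <= rho ^+ k.
  rewrite /A normr_prod -[k in leRHS]card_ord -prodr_const ler_prod// => i _.
  by rewrite normr_ge0/=.
have := IH (fun i => a (widen_ord (leqnSn k) i)) (fun i => b (widen_ord (leqnSn k) i)).
rewrite -/A -/B => /(_ (fun=> ha _) (fun=> hb _) (fun=> hab _)) hAB.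
rewrite -(@natr1 R k) mulrDl mul1r mulrDl addrC; apply: lerD; last first.
  by apply: ler_pM.
have {hAB}hAB := ler_pM (normr_ge0 _) (normr_ge0 _) hAB (hb ord_max).
apply: (le_trans hAB); case: k {IH a b ha hb hab A B hA hAB} => [|k].
  by rewrite !mul0r.
by rewrite /= exprSr -!mulrA (mulrC delta).
Qed.

Context {E : normedModType R}.

(** Supplies the point of the dual ball at which all suprema below vanish. *)
Definition zero_form : {scalar E} := \0%R.

Lemma dual_ball0 : dual_ball zero_form.
Proof. by move=> x; rewrite /zero_form /= normr0. Qed.

Lemma dual_ball_dist (f : {scalar E}) x y : dual_ball f -> `|f x - f y| <= `|x - y|.
Proof. by move=> Df; rewrite -linearB; exact: Df. Qed.

Section Embeddings.
Context {k : nat} {T S : completeNormedModType R}.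
Context (iT : {linear tensor k E -> T}) (hT : is_completion (@inj_norm R k E) iT).
Context (iS : {linear sym_tensor k E -> S})
        (hS : is_completion (@sym_inj_norm R k E) iS).

Lemma norm_sym_tpow_sum n (c : 'I_n -> R) (x : 'I_n -> E) :
  `|\sum_(j < n) c j *: iS (sym_tpow k (x j))| =
  sup [set `|\sum_(j < n) c j * f (x j) ^+ k| | f in @dual_ball R E].
Proof.
have -> : \sum_(j < n) c j *: iS (sym_tpow k (x j)) =
    iS (\sum_(j < n) c j *: sym_tpow k (x j)).
  by rewrite linear_sum; apply: eq_bigr => j _; rewrite linearZ.
rewrite hS.1; apply: sym_inj_normE.
elim/big_rec2: _ => //= j U V _ <-.
by [].
Qed.

Lemma norm_sym_tpow_le x y rho : `|x| <= rho -> `|y| <= rho ->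
  `|iS (sym_tpow k x) - iS (sym_tpow k y)| <= k%:R * rho ^+ k.-1 * `|x - y|.
Proof.
move=> xr yr; rewrite -linearB hS.1 /sym_inj_norm.
apply: ge_sup; first by eexists; exists zero_form; [exact: dual_ball0|reflexivity].
move=> _ [f Df <-].
have -> : (sym_tpow k x - sym_tpow k y) (prod_form (fun=> f)) =
   \prod_(n < k) f x - \prod_(n < k) f y by [].
by apply: prod_diff_le => // i;
  [exact: le_trans (Df x) xr|exact: le_trans (Df y) yr|exact: dual_ball_dist].
Qed.

(** The product of f_i(x) over the k forms is Lipschitz in x on balls,
    uniformly over the dual ball. The bound has the same shape as the one for
    the symmetric norm, so that one approximation argument serves both
    completions. *)
Lemma norm_tpow_le x y rho : `|x| <= rho -> `|y| <= rho ->
  `|iT (tpow k x) - iT (tpow k y)| <= k%:R * rho ^+ k.-1 * `|x - y|.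
Proof.
move=> xr yr; rewrite -linearB hT.1 /inj_norm.
apply: ge_sup.
  by eexists; exists (fun=> zero_form); [move=> ?; exact: dual_ball0|reflexivity].
move=> _ [f Df <-].
have -> : (tpow k x - tpow k y) (prod_form f) =
   \prod_(n < k) f n x - \prod_(n < k) f n y by [].
by apply: prod_diff_le => // i;
  [exact: le_trans (Df i x) xr|exact: le_trans (Df i y) yr|exact: dual_ball_dist].
Qed.

End Embeddings.
End TensorNorms.

(** * Rademacher sums of powers *)

Section RademacherBound.
Context {R : realType} {E : normedModType R}.

(** The Kahane-Khintchine inequality and type p combined, for n vectors and
    raised to the power q: it holds with kappa = K tau. *)
Definition rademacher_bound (n : nat) (p q kappa : R) :=
  forall y : 'I_n -> E, sign_mean (fun e => `|\sum_j sign_at e j *: y j| `^ q) <=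
     kappa `^ q * (\sum_j `|y j| `^ p) `^ (q / p).

(** The triangle inequality always provides a finite constant. It shows that
    the error is in L_q whatever the value of K_(q,p), and forces the error to
    vanish when the moment of xi_1 does. *)
Lemma rademacher_bound_trivial n p q : 0 < p -> 0 < q ->
  rademacher_bound n p q n%:R.
Proof.
move=> p0 q0 y; set s := \sum_j _.
have s0 : 0 <= s by apply: sumr_ge0 => j _; exact: powR_ge0.
rewrite -[leRHS](@sign_mean_cst R n); apply: ler_sign_mean => e.
rewrite (mulrC q) powRrM -powRM ?powR_ge0//.
apply: ge0_ler_powR; rewrite ?nnegrE ?mulr_ge0 ?powR_ge0 ?(ltW q0)//.
apply: (le_trans (ler_norm_sum _ _ _)).
apply: (@le_trans _ _ (\sum_(j < n) s `^ p^-1)); last first.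
  by rewrite sumr_const card_ord mulr_natl.
apply: ler_sum => j _; rewrite normrZ.
have -> : `|sign_at e j| = 1 :> R.
  by rewrite /sign_at; case: (e j); rewrite ?normrN normr1.
rewrite mul1r -[leLHS](@powRr1 R)// -(@divff _ p) ?gt_eqF// powRrM.
apply: ge0_ler_powR; rewrite ?nnegrE ?powR_ge0 ?invr_ge0 ?(ltW p0)//.
by rewrite /s (bigD1 j)//= lerDl sumr_ge0// => i _; exact: powR_ge0.
Qed.

End RademacherBound.

Section RademacherTensors.
Context {R : realType} {E : normedModType R} {k : nat} {S : completeNormedModType R}.
Context (iS : {linear sym_tensor k E -> S})
        (hS : is_completion (@sym_inj_norm R k E) iS).
Hypothesis k0 : (0 < k)%N.

(** The contraction principle on the dual ball, with f(x_j)^k against k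
    |x_j|^(k-1) f(x_j). The absolute value in the injective norm is split into
    its positive and negative parts, which are equally distributed because all
    signs can be reversed; this costs the factor 2. *)
Lemma rademacher_tpow n (x : 'I_n -> E) q : 1 <= q ->
  sign_mean (fun e => `|\sum_j sign_at e j *: iS (sym_tpow k (x j))| `^ q) <=
  (2 * k%:R) `^ q *
  sign_mean (fun e => `|\sum_j sign_at e j *: (`|x j| ^+ k.-1 *: x j)| `^ q).
Proof.
move=> q1; have q0 : 0 <= q by apply: le_trans q1.
pose D := @dual_ball R E; pose f0 := @zero_form R E.
have Df0 : D f0 := @dual_ball0 R E.
pose u (j : 'I_n) (f : {scalar E}) : R := f (x j) ^+ k.
pose v (j : 'I_n) (f : {scalar E}) : R := k%:R * `|x j| ^+ k.-1 * f (x j).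
have bu j : bounded_on D (u j).
  exists (`|x j| ^+ k) => f Df; rewrite normrX.
  by apply: lerXn2r; rewrite ?nnegrE//; exact: Df.
have bv j : bounded_on D (v j).
  exists (k%:R * `|x j| ^+ k.-1 * `|x j|) => f Df.
  rewrite normrM ger0_norm ?mulr_ge0 ?exprn_ge0//.
  by apply: ler_wpM2l; [rewrite mulr_ge0 ?exprn_ge0|exact: Df].
have u0 j : u j f0 = 0 by rewrite /u /f0 /zero_form/= expr0n eqn0Ngt k0.
have v0 j : v j f0 = 0 by rewrite /v /f0 /zero_form/= mulr0.
have lip j f f' : D f -> D f' -> `|u j f - u j f'| <= `|v j f - v j f'|.
  move=> Df Df'; rewrite /v -mulrBr normrM ger0_norm ?mulr_ge0 ?exprn_ge0//.
  have <- : \prod_(i < k) f (x j) - \prod_(i < k) f' (x j) = u j f - u j f'.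
    by rewrite !prodr_const card_ord.
  by apply: prod_diff_le.
have bsum (w : 'I_n -> {scalar E} -> R) (e : signs n) :
    (forall j, bounded_on D (w j)) ->
    has_sup [set \sum_j sign_at e j * w j f | f in D].
  move=> bw; split; first by eexists; exists f0; [exact: Df0|reflexivity].
  have [C HC] := bounded_on_sum xpredT e bw.
  by exists C => _ [f Df <-]; apply: le_trans (HC f Df); exact: ler_norm.
have le_sup_u e f : D f -> \sum_j sign_at e j * u j f <= rademacher_sup D u e.
  by move=> Df; apply: (ub_le_sup (bsum u e bu).2); exists f.
have u_ge0 e : 0 <= rademacher_sup D u e.
  by apply: le_trans (le_sup_u e f0 Df0); rewrite big1// => j _; rewrite u0 mulr0.
(* the opposite of the sum for e is the sum for the reversed signs *)
have le1 e : `|\sum_j sign_at e j *: iS (sym_tpow k (x j))| <=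
    rademacher_sup D u e + rademacher_sup D u (flip xpredT e).
  rewrite (norm_sym_tpow_sum hS); apply: ge_sup.
    by eexists; exists f0; [exact: Df0|reflexivity].
  move=> _ [f Df <-]; rewrite ler_norml; apply/andP; split.
    rewrite lerNl; apply: (@le_trans _ _ (rademacher_sup D u (flip xpredT e))).
      apply: le_trans (le_sup_u _ f Df); rewrite -sumrN.
      by apply: ler_sum => j _; rewrite sign_at_flip mulNr.
    by rewrite lerDr.
  by apply: (le_trans (le_sup_u e f Df)); rewrite lerDl.
apply: (@le_trans _ _ (2 `^ q * sign_mean (fun e => rademacher_sup D u e `^ q))).
  apply: (@le_trans _ _ (sign_mean (fun e => 2 `^ q / 2 *
     (rademacher_sup D u e `^ q + rademacher_sup D u (flip xpredT e) `^ q)))).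
    apply: ler_sign_mean => e; apply: le_trans (powR_jensenD q1 (u_ge0 _) (u_ge0 _)).
    by apply: ge0_ler_powR => //; rewrite nnegrE ?addr_ge0.
  rewrite sign_meanZ sign_meanD.
  rewrite (sign_mean_flip xpredT (fun e => rademacher_sup D u e `^ q)).
  by rewrite -mulrA ler_wpM2l ?powR_ge0// le_eqVlt; apply/orP; left; apply/eqP; field.
rewrite powRM// -mulrA ler_wpM2l ?powR_ge0// -sign_meanZ.
apply: (le_trans (rademacher_contraction Df0 q1 bu bv u0 v0 lip)).
apply: ler_sign_mean => e; rewrite -powRM// ge0_ler_powR ?nnegrE ?mulr_ge0//.
  apply: (le_trans _ (ub_le_sup (bsum v e bv).2 _)); last by exists f0.
  by rewrite big1// => j _; rewrite v0 mulr0.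
apply: ge_sup; first by eexists; exists f0; [exact: Df0|reflexivity].
move=> _ [f Df <-].
have -> : \sum_j sign_at e j * v j f =
    k%:R * f (\sum_j sign_at e j *: (`|x j| ^+ k.-1 *: x j)).
  rewrite linear_sum mulr_sumr; apply: eq_bigr => j _.
  by rewrite !linearZ/= /v; ring.
by rewrite ler_wpM2l//; apply: (le_trans (ler_norm _)); exact: Df.
Qed.

(** The vectors |x_j|^(k-1) x_j have norm |x_j|^k, so the sum over j of
    |x_j|^(kp) appears; since p <= q, the power mean inequality converts it to
    exponent kq and produces the power of n. *)
Lemma rademacher_tpow_type n (x : 'I_n -> E) p q kappa :
  0 < p -> 1 <= q -> p <= q -> 0 <= kappa -> (0 < n)%N ->
  @rademacher_bound R E n p q kappa ->
  sign_mean (fun e => `|\sum_j sign_at e j *: iS (sym_tpow k (x j))| `^ q) <=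
  (2 * k%:R * kappa) `^ q * (n%:R `^ (q / p) / n%:R) *
    \sum_j (`|x j| ^+ k) `^ q.
Proof.
move=> p0 q1 pq kappa0 n0 type_n.
apply: (le_trans (rademacher_tpow x q1)).
rewrite [in leRHS]powRM ?mulr_ge0// -!mulrA ler_wpM2l ?powR_ge0//.
apply: (le_trans (type_n _)); rewrite ler_wpM2l ?powR_ge0//.
have qp1 : 1 <= q / p by rewrite ler_pdivlMr// mul1r.
have := @powR_sum_le R 'I_n (fun j => (`|x j| ^+ k) `^ p) (q / p) qp1.
rewrite card_ord -mulrA => /(_ n0 (fun=> powR_ge0 _ _)).
have -> : \sum_j ((`|x j| ^+ k) `^ p) `^ (q / p) = \sum_j (`|x j| ^+ k) `^ q.
  by apply: eq_bigr => j _; rewrite -powRrM mulrCA divff ?mulr1// gt_eqF.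
suff -> : \sum_j `|(`|x j| ^+ k.-1) *: x j| `^ p = \sum_j (`|x j| ^+ k) `^ p by [].
apply: eq_bigr => j _; rewrite normrZ normrX normr_id.
by rewrite -exprSr prednK.
Qed.

End RademacherTensors.

(** * Symmetrization for finite product laws *)

Section Symmetrization.
Context {R : realType} {A : finType} (w : A -> R) {M : nat}.
Hypothesis w0 : forall a, 0 <= w a.
Hypothesis w1 : \sum_a w a = 1.

(** Law of M independent draws from w. *)
Definition product_weight (a : {ffun 'I_M -> A}) : R := \prod_j w (a j).

Lemma product_weight_ge0 a : 0 <= product_weight a.
Proof. by apply: prodr_ge0 => j _; exact: w0. Qed.

Lemma product_weight_sum : \sum_a product_weight a = 1.
Proof.
rewrite /product_weight -(bigA_distr_bigA (fun _ => w)).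
by rewrite w1 big1.
Qed.

Lemma product_weight_marginal {V : lmodType R} (g : A -> V) (j : 'I_M) :
  \sum_a product_weight a *: g (a j) = \sum_c w c *: g c.
Proof.
(* the indicator of a j == c is a product over the coordinates, so its total
   weight is a product of sums *)
have E c : \sum_(a : {ffun 'I_M -> A} | a j == c) product_weight a = w c.
  pose F i b := if i == j then (if b == c then w b else 0) else w b.
  transitivity (\prod_i \sum_b F i b).
    rewrite (bigA_distr_bigA F) big_mkcond/=; apply: eq_bigr => a _.
    rewrite /product_weight (bigD1 j)//= [in RHS](bigD1 j)//= /F eqxx.
    case: ifP => _; last by rewrite mul0r.
    by congr (_ * _); apply: eq_bigr => i /negbTE ->.
  rewrite (bigD1 j)//= [X in _ * X]big1; last first.
    by move=> i /negbTE ij; rewrite /F ij.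
  rewrite mulr1 /F eqxx (bigD1 c)//= eqxx big1 ?addr0// => b /negbTE bc.
  by rewrite bc.
rewrite (partition_big (fun a : {ffun 'I_M -> A} => a j) xpredT)//=.
apply: eq_bigr => c _; rewrite -E scaler_suml.
by apply: eq_bigr => a /eqP ->.
Qed.

(** An independent copy b of the sample a is averaged inside the norm by
    Jensen's inequality; then a_j and b_j are exchangeable, so signs may be
    inserted; the triangle inequality separates a from b. *)
Lemma symmetrization {V : normedModType R} (g : A -> V) q : 1 <= q ->
  \sum_a product_weight a *
     `|\sum_(j < M) (\sum_c w c *: g c - g (a j))| `^ q <=
  2 `^ q * \sum_a product_weight a *
     sign_mean (fun e => `|\sum_j sign_at e j *: g (a j)| `^ q).
Proof.
move=> q1; have q0 : 0 <= q by apply: le_trans q1.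
set m := \sum_c w c *: g c.
pose W := product_weight.
pose Z (e : signs M) := \sum_a \sum_b W a * W b *
  `|\sum_j sign_at e j *: (g (b j) - g (a j))| `^ q.
pose eT : signs M := [ffun=> true].
(* the mean m is an average over an independent sample b; Jensen's inequality
   takes that average out of the norm *)
have step1 : \sum_a W a * `|\sum_(j < M) (m - g (a j))| `^ q <= Z eT.
  apply: ler_sum => a _.
  under [leRHS]eq_bigr do rewrite -mulrA.
  rewrite -mulr_sumr ler_wpM2l ?product_weight_ge0//.
  apply: le_trans (powR_jensen q1 product_weight_ge0 product_weight_sum
    (fun=> normr_ge0 _)).
  apply: ge0_ler_powR; rewrite ?nnegrE ?sumr_ge0//.
    by move=> b _; rewrite mulr_ge0 ?product_weight_ge0.
  have -> : \sum_(j < M) (m - g (a j)) =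
      \sum_b W b *: \sum_j sign_at eT j *: (g (b j) - g (a j)).
    under [RHS]eq_bigr do rewrite scaler_sumr.
    rewrite exchange_big/=; apply: eq_bigr => j _.
    under eq_bigr => b _ do rewrite /sign_at ffunE scale1r scalerBr.
    rewrite sumrB; congr (_ - _); first by rewrite product_weight_marginal.
    by rewrite -scaler_suml product_weight_sum scale1r.
  apply: (le_trans (ler_norm_sum _ _ _)); apply: ler_sum => b _.
  by rewrite normrZ ger0_norm ?product_weight_ge0.
(* the exchange of a_j and b_j at the negative signs of e is an involution that
   preserves the weight and flips the corresponding terms *)
have step2 e : Z eT = Z e.
  rewrite /Z !pair_big/=.
  pose sw (ab : {ffun 'I_M -> A} * {ffun 'I_M -> A}) :=
    ([ffun j => if e j then ab.1 j else ab.2 j],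
     [ffun j => if e j then ab.2 j else ab.1 j]).
  have swK : involutive sw.
    case=> a b; rewrite /sw/=; congr pair; apply/ffunP => j; rewrite !ffunE;
      by case: (e j).
  rewrite (reindex_inj (inv_inj swK)); apply: eq_bigr => -[a b] _ /=.
  congr (_ * _).
    rewrite /W /product_weight -!big_split/=; apply: eq_bigr => j _.
    by rewrite !ffunE; case: (e j) => //; rewrite mulrC.
  congr (`|_| `^ _); apply: eq_bigr => j _; rewrite /sign_at !ffunE.
  by case: (e j); rewrite ?scale1r// scaleN1r opprB.
(* each of the two samples contributes half of the bound *)
have step3 e : Z e <= 2 `^ q * \sum_a W a * `|\sum_j sign_at e j *: g (a j)| `^ q.
  pose H a := `|\sum_j sign_at e j *: g (a j)| `^ q : R.
  apply: (@le_trans _ _ (\sum_a \sum_b W a * W b * (2 `^ q / 2 * (H b + H a)))).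
    apply: ler_sum => a _; apply: ler_sum => b _.
    rewrite ler_wpM2l ?mulr_ge0 ?product_weight_ge0//.
    apply: le_trans (powR_jensenD q1 (normr_ge0 _) (normr_ge0 _)).
    apply: ge0_ler_powR; rewrite ?nnegrE ?addr_ge0//.
    under eq_bigr do rewrite scalerBr.
    by rewrite sumrB; exact: ler_normB.
  have e1 : \sum_a \sum_b W a * W b * H b = \sum_a W a * H a.
    under eq_bigr do under eq_bigr do rewrite -mulrA.
    under eq_bigr do rewrite -mulr_sumr.
    by rewrite -mulr_suml product_weight_sum mul1r.
  have e2 : \sum_a \sum_b W a * W b * H a = \sum_a W a * H a.
    rewrite exchange_big/= -[RHS]e1.
    by apply: eq_bigr => a _; apply: eq_bigr => b _; rewrite (mulrC (W _)).
  rewrite le_eqVlt; apply/orP; left; apply/eqP.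
  have -> : \sum_a \sum_b W a * W b * (2 `^ q / 2 * (H b + H a)) =
     2 `^ q / 2 * (\sum_a \sum_b W a * W b * H b + \sum_a \sum_b W a * W b * H a).
    rewrite -big_split/= mulr_sumr; apply: eq_bigr => a _.
    rewrite -big_split/= mulr_sumr; apply: eq_bigr => b _; ring.
  by rewrite e1 e2; field.
apply: (le_trans step1); rewrite -(@sign_mean_cst R M (Z eT)).
apply: (@le_trans _ _ (sign_mean (fun e : signs M =>
   2 `^ q * \sum_a W a * `|\sum_j sign_at e j *: g (a j)| `^ q))).
  by apply: ler_sign_mean => e; rewrite (step2 e); exact: step3.
rewrite sign_meanZ ler_wpM2l ?powR_ge0// /sign_mean.
rewrite exchange_big/= mulr_sumr; apply: ler_sum => a _.
by rewrite -mulr_sumr mulrCA.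
Qed.

End Symmetrization.

(** * The law of large numbers for finitely valued samples *)

Section FiniteLaw.
Context {R : realType} {E : normedModType R} {k : nat} {S : completeNormedModType R}.
Context (iS : {linear sym_tensor k E -> S})
        (hS : is_completion (@sym_inj_norm R k E) iS).
Hypothesis k0 : (0 < k)%N.

(** With q-th powers on both sides: symmetrization and the bound for fixed
    vectors give M^(-q) 2^q (2 k kappa)^q M^(q/p - 1), and the sum over j
    contributes another M. *)
Lemma finite_slln {A : finType} (w : A -> R) (x : A -> E) (M : nat) p q kappa :
  (forall a, 0 <= w a) -> \sum_a w a = 1 ->
  1 <= p -> p <= q -> 0 <= kappa -> (0 < M)%N ->
  @rademacher_bound R E M p q kappa ->
  \sum_a @product_weight R A w M a *
     `|\sum_c w c *: iS (sym_tpow k (x c)) -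
       M%:R^-1 *: \sum_(j < M) iS (sym_tpow k (x (a j)))| `^ q <=
  (4 * k%:R * kappa * M%:R `^ (- (1 - p^-1))) `^ q *
  \sum_c w c * (`|x c| ^+ k) `^ q.
Proof.
move=> w0 w1 p1 pq kappa0 M0 hk.
have q1 : 1 <= q by apply: le_trans pq.
have p0 : 0 < p by apply: lt_le_trans p1.
have q0 : 0 < q by apply: lt_le_trans q1.
set m := \sum_c w c *: _; pose g c := iS (sym_tpow k (x c)).
have MR : 0 < M%:R :> R by rewrite ltr0n.
pose W := @product_weight R A w M.
have rescale (a : {ffun 'I_M -> A}) :
   `|m - M%:R^-1 *: \sum_(j < M) g (a j)| `^ q =
   (M%:R^-1) `^ q * `|\sum_(j < M) (m - g (a j))| `^ q.
  rewrite -powRM ?invr_ge0 ?(ltW MR)//; congr (_ `^ _).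
  rewrite -[X in X * _]ger0_norm ?invr_ge0 ?(ltW MR)// -normrZ; congr `|_|.
  rewrite sumrB sumr_const card_ord scalerBr; congr (_ - _).
  rewrite -(scaler_nat M m) scalerA mulVf ?scale1r// ?gt_eqF//.
under eq_bigr => a _ do rewrite rescale mulrCA.
rewrite -mulr_sumr.
apply: (@le_trans _ _ ((M%:R^-1) `^ q * (2 `^ q * \sum_a W a *
   ((2 * k%:R * kappa) `^ q * (M%:R `^ (q / p) / M%:R) *
    \sum_(j < M) (`|x (a j)| ^+ k) `^ q)))).
  rewrite ler_wpM2l ?powR_ge0//.
  apply: (le_trans (symmetrization (M := M) w0 w1 g q1)).
  rewrite ler_wpM2l ?powR_ge0//; apply: ler_sum => a _.
  rewrite ler_wpM2l ?product_weight_ge0//.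
  exact: (rademacher_tpow_type hS k0 (fun j => x (a j)) p0 q1 pq kappa0 M0 hk).
have marg : \sum_a W a * \sum_(j < M) (`|x (a j)| ^+ k) `^ q =
    M%:R * \sum_c w c * (`|x c| ^+ k) `^ q.
  under eq_bigr do rewrite mulr_sumr.
  rewrite exchange_big/=.
  under eq_bigr => j _ do
    rewrite (@product_weight_marginal R A w M w1 R^o (fun c => (`|x c| ^+ k) `^ q) j).
  by rewrite sumr_const card_ord mulr_natl.
under eq_bigr => a _ do rewrite mulrCA.
rewrite -mulr_sumr marg.
set s := \sum_c _.
rewrite le_eqVlt; apply/orP; left; apply/eqP.
have -> : M%:R^-1 `^ q = M%:R `^ (-1 * q) :> R by rewrite powRrM powR_inv1// ltW.
have -> : 4 * k%:R * kappa * M%:R `^ (- (1 - p^-1)) =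
   2 * (2 * k%:R * kappa) * M%:R `^ (- (1 - p^-1)) by ring.
have u0 : 0 <= 2 * k%:R * kappa by rewrite !mulr_ge0.
set u := 2 * k%:R * kappa in u0 *.
rewrite (@powRM _ (2 * u)) ?powR_ge0 ?mulr_ge0// (@powRM _ 2 u)// -powRrM.
have -> : - (1 - p^-1) * q = -1 * q + q / p by ring.
have Mn0 : M%:R != 0 :> R by rewrite gt_eqF.
rewrite powRD ?Mn0 ?implybT//.
by field.
Qed.

End FiniteLaw.

(** * Finitely valued random variables *)

Section FinitelyValued.
Context {R : realType} {d : measure_display} {T : measurableType d}.
Variable P : probability T R.
Context {A : finType} (g : T -> A).
Hypothesis mg : forall a, measurable (g @^-1` [set a]).

(** The weights P(g = a) as real numbers, so that finite sums over A need no
    extended reals. *)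
Definition law (a : A) : R := fine (P (g @^-1` [set a])).

Lemma law_ge0 a : 0 <= law a.
Proof. by rewrite fine_ge0. Qed.

Lemma lawE a : (law a)%:E = P (g @^-1` [set a]).
Proof. by rewrite fineK// fin_num_measure. Qed.

Lemma measurable_preimage_fin (B : set A) : measurable (g @^-1` B).
Proof.
rewrite (_ : g @^-1` B = \big[setU/set0]_(a <- enum A | a \in B) (g @^-1` [set a])).
  by apply: bigsetU_measurable => a _.
apply/seteqP; split=> w /=.
  move=> Bgw; rewrite -bigcup_seq_cond; exists (g w) => //=.
  by rewrite mem_enum mem_set.
by rewrite -bigcup_seq_cond => -[a /= /andP[_ /set_mem Ba] ->].
Qed.

Lemma integral_finitely_valued (h : A -> R) : (forall a, 0 <= h a) ->
  (\int[P]_w (h (g w))%:E = (\sum_a law a * h a)%:E)%E.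
Proof.
move=> h0.
transitivity (\int[P]_w (\sum_(a <- enum A) (h a * \1_(g @^-1` [set a]) w)%:E))%E.
  apply: eq_integral => w _; rewrite sumEFin big_enum/=; congr EFin.
  rewrite (bigD1 (g w))//= big1; first by rewrite indicE mem_set// mulr1 addr0.
  by move=> a aw; rewrite indicE memNset ?mulr0//=; apply/eqP; rewrite eq_sym.
rewrite ge0_integral_sum//.
- rewrite -sumEFin big_enum/=; apply: eq_bigr => a _.
  rewrite (integralZl_indic measurableT (fun=> g @^-1` [set a]))//; last first.
    by move=> /lt_geF; rewrite h0.
  by rewrite integral_indic// setIT mulrC EFinM lawE.
- move=> a; apply/measurable_EFinP; apply: measurable_funM => //.
- by move=> a w _; rewrite lee_fin mulr_ge0.
Qed.

Lemma law_sum1 : \sum_a law a = 1.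
Proof.
apply: EFin_inj; rewrite -(probability_setT P) -[RHS]mul1e.
rewrite -(integral_cst P measurableT 1%:E).
rewrite (@integral_finitely_valued (fun=> 1%R))//.
by congr EFin; apply: eq_bigr => a _; rewrite mulr1.
Qed.

End FinitelyValued.

(** * The probability space of signs *)

(** A copy of the finite set of signs that carries the discrete sigma-algebra;
    every set being measurable, each measure on it is complete. *)
Definition sign_space (n : nat) := signs n.

HB.instance Definition _ n := Finite.on (sign_space n).
HB.instance Definition _ n :=
  isPointed.Build (sign_space n) ([ffun=> true] : signs n).
HB.instance Definition _ n := @isMeasurable.Build default_measure_display
  (sign_space n) discrete_measurable (@discrete_measurable0 _)
  (@discrete_measurableC _) (@discrete_measurableU _).

Section SignSpace.
Context {R : realType} (n : nat).

Let two_gt0 : 0 <= (2 ^+ n)^-1 :> R.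
Proof. by rewrite invr_ge0 exprn_ge0. Qed.

Let atoms (i : nat) : {measure set (sign_space n) -> \bar R} :=
  dirac (nth point (enum (sign_space n)) i).

(** The uniform probability. *)
Definition sign_prob : set (sign_space n) -> \bar R :=
  mscale (NngNum two_gt0) (msum atoms #|sign_space n|).

HB.instance Definition _ := Measure.on sign_prob.

Lemma sign_probE (X : set (sign_space n)) :
  sign_prob X = (sign_mean (fun e : signs n => \1_X e : R))%:E.
Proof.
rewrite /sign_prob /mscale/= /msum /sign_mean EFinM; congr (_ * _)%E.
rewrite -sumEFin.
transitivity (\sum_(e <- enum (sign_space n)) (\1_X e)%:E : \bar R)%E; last first.
  by rewrite big_enum.
rewrite cardE (big_nth point) big_mkord/=.
by apply: eq_bigr => i _; rewrite /atoms diracE indicE.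
Qed.

Lemma sign_probT : sign_prob setT = 1%E.
Proof.
rewrite sign_probE (_ : (fun _ => _) = fun=> 1); first by rewrite sign_mean_cst.
by apply/funext => e; rewrite indicT.
Qed.

HB.instance Definition _ := Measure_isProbability.Build _ _ _ sign_prob sign_probT.

Lemma sign_prob_complete : measure_is_complete sign_prob.
Proof. by []. Qed.

Definition coordinate_sign (j : 'I_n) (e : sign_space n) : R := sign_at e j.

(** The signs are independent because summing a product over all sign vectors
    is the product of the sums over the two values of each sign. *)
Lemma coordinate_sign_event (J : {set 'I_n}) (B : 'I_n -> set R) :
  sign_prob (\big[setI/setT]_(i in J) (coordinate_sign i @^-1` B i)) =
  (\prod_(i in J) ((\1_(B i) 1 + \1_(B i) (-1)) / 2)%:E)%E.
Proof.
rewrite sign_probE /sign_mean.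
pose F i (b : bool) : R := if i \in J then \1_(B i) (if b then 1 else -1) else 1.
have -> : \sum_(e : signs n)
      \1_(\big[setI/setT]_(i in J) (coordinate_sign i @^-1` B i)) e
    = \prod_i \sum_b F i b.
  rewrite bigA_distr_bigA; apply: eq_bigr => e _.
  rewrite /F -big_mkcond/=; elim/big_rec2: _ => [|i Y y iJ <-].
    by rewrite indicT.
  by rewrite indicI/= /coordinate_sign/sign_at !indicE.
have -> : (2 ^+ n)^-1 = \prod_(i < n) 2^-1 :> R.
  by rewrite prodr_const card_ord exprVn.
rewrite -big_split/= prodEFin; congr EFin.
rewrite [RHS]big_mkcond/=; apply: eq_bigr => i _.
by rewrite big_bool/= /F; case: ifP => _; field.
Qed.

Lemma coordinate_sign_rademacher :
  rademacher_family sign_prob coordinate_sign.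
Proof.
have single j (B : set R) : sign_prob (coordinate_sign j @^-1` B) =
    ((\1_B 1 + \1_B (-1)) / 2)%:E.
  have := coordinate_sign_event [set j] (fun=> B).
  by rewrite !big_set1.
split=> //.
- by move=> i e; rewrite /coordinate_sign /sign_at; case: (e i); [left|right].
- have n1 : (1 : R) != -1 by rewrite -subr_eq0 opprK -mulr2n pnatr_eq0.
  move=> i; rewrite /= !single !indicE; split; congr EFin.
    by rewrite mem_set// memNset/= ?addr0 ?mul1r// => /esym/eqP; rewrite (negbTE n1).
  by rewrite memNset/= ?mem_set// ?add0r ?mul1r// => /eqP; rewrite (negbTE n1).
- move=> J B _; rewrite /= coordinate_sign_event.
  by apply: eq_bigr => i _; rewrite single.
Qed.

Lemma Lqnorm_sign_space (F : normedModType R) (h : sign_space n -> F) r : 0 < r ->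
  Lqnorm sign_prob r h = ((sign_mean (fun e => `|h e| `^ r)) `^ r^-1)%:E.
Proof.
move=> r0; rewrite /Lqnorm unlock /= -poweR_EFin; congr poweR.
under eq_integral => e _ do rewrite /= normr_id.
rewrite (@integral_finitely_valued R _ _ sign_prob (sign_space n) id _
  (fun e => `|h e| `^ r))//.
congr EFin; rewrite /sign_mean mulr_sumr; apply: eq_bigr => e _; congr (_ * _).
apply: EFin_inj; rewrite lawE//= sign_probE; congr EFin.
rewrite /sign_mean (bigD1 e)//= big1.
  by rewrite indicE mem_set// addr0 mulr1.
by move=> e' e'e; rewrite indicE memNset//=; exact/eqP.
Qed.

End SignSpace.

(** * Kahane-Khintchine and type constants *)

Section Constants.
Context {R : realType} {E : completeNormedModType R}.

(** Both defining inequalities are applied on the finite space of signs. *)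
Lemma rademacher_bound_kahane_type n p q K tau : 1 <= p -> p <= q ->
  0 < K -> 0 < tau -> kahane_khintchine_bound q p K -> type_bound E p tau ->
  @rademacher_bound R E n p q (K * tau).
Proof.
move=> p1 pq K0 tau0 kk ty y.
have p0 : 0 < p by apply: lt_le_trans p1.
have q0 : 0 < q by apply: lt_le_trans pq.
have := kk _ _ _ (@sign_prob_complete R n) E n _ y (@coordinate_sign_rademacher R n).
have := ty _ _ _ (@sign_prob_complete R n) n _ y (@coordinate_sign_rademacher R n).
rewrite !Lqnorm_sign_space// -EFinM !lee_fin.
have rsE : (rademacher_sum (@coordinate_sign R n) y : _ -> E) =
  (fun e => \sum_j sign_at e j *: y j) by [].
rewrite rsE; set s := \sum_j _ => H1 H2.
have s0 : 0 <= s by apply: sumr_ge0 => j _; exact: powR_ge0.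
have {H1 H2}H := le_trans H2 (ler_wpM2l (ltW K0) H1).
have Q x : 0 <= x -> (x `^ q^-1) `^ q = x.
  by move=> x0; rewrite -powRrM mulVf ?powRr1// gt_eqF.
set m := sign_mean _ in H *.
have m0 : 0 <= m by apply: sign_mean_ge0 => e; exact: powR_ge0.
rewrite -(Q m m0) (mulrC q) powRrM -powRM ?powR_ge0 ?mulr_ge0 ?(ltW K0) ?(ltW tau0)//.
apply: ge0_ler_powR;
  rewrite ?nnegrE ?powR_ge0 ?mulr_ge0 ?powR_ge0 ?(ltW q0) ?(ltW K0) ?(ltW tau0)//.
by rewrite -mulrA.
Qed.

(** With a single vector the type inequality reads |x| <= tau |x|, so
    arbitrarily small admissible tau leave only the zero space. *)
Lemma type_constant_eq0 p (x : E) : 0 < p ->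
  type_constant E p = 0%E -> x = 0.
Proof.
move=> p0 tau0; apply/eqP; rewrite -normr_le0.
rewrite leNgt; apply/negP => x0.
have : (1%:E <= type_constant E p)%E; last by rewrite tau0 lee_fin ler10.
apply: le_ereal_inf_tmp => _ [tau [tau_gt0 ty] <-]; rewrite lee_fin.
have := ty _ _ _ (@sign_prob_complete R 1) 1%N _ (fun=> x) (@coordinate_sign_rademacher R 1).
rewrite Lqnorm_sign_space// lee_fin big_ord1.
have -> : sign_mean (fun e => `|rademacher_sum (@coordinate_sign R 1) (fun=> x) e| `^ p) =
    `|x| `^ p.
  rewrite -[RHS](@sign_mean_cst R 1); congr sign_mean; apply/funext => e.
  rewrite /rademacher_sum big_ord1 normrZ /coordinate_sign /sign_at.
  by case: (e _); rewrite ?normrN normr1 mul1r.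
rewrite -powRrM divff ?gt_eqF// powRr1//.
by rewrite -[leLHS]mul1r ler_pM2r.
Qed.

(** For y > 0, x / y is a lower bound of X. For y = 0 any element of X will
    do, and X is nonempty because its infimum is finite. *)
Lemma le_ereal_inf_mulr (X : set R) (x y t : R) : 0 <= y ->
  ereal_inf [set z%:E | z in X] = t%:E ->
  (forall z, X z -> x <= z * y) -> x <= t * y.
Proof.
rewrite le_eqVlt => /predU1P[<- tE H|y0 tE H].
  have [X0|/set0P[z Xz]] := eqVneq X set0.
    by move: tE; rewrite X0 image_set0 ereal_inf0.
  by have := H z Xz; rewrite !mulr0.
rewrite -ler_pdivrMr// -lee_fin -tE; apply: le_ereal_inf_tmp => _ [z Xz <-].
by rewrite lee_fin ler_pdivrMr//; exact: H.
Qed.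

(** L is the norm of the error, u the power of M and v the moment of xi_1.
    When tau = 0 the space is trivial and kappa = 0 is admissible; when K =
    +oo and tau and v are positive the right-hand side is +oo. *)
Lemma slln_constant_bound M p q (B : R) k (L u v : R) :
  1 <= p -> p <= q -> rademacher_type E p -> 0 < B -> (0 < k)%N ->
  0 < u -> 0 <= v ->
  (forall kappa, 0 <= kappa -> @rademacher_bound R E M p q kappa ->
     L <= kappa * (4 * k%:R * u * v)) ->
  (L%:E <= slln_constant E q p k B * u%:E * v%:E)%E.
Proof.
move=> p1 pq hE B0 k0 u0 v0 H.
have p0 : 0 < p by apply: lt_le_trans p1.
have q0 : 0 < q by apply: lt_le_trans pq.
have kR : 0 < k%:R :> R by rewrite ltr0n.
have kk0 : (0 <= @kahane_khintchine R q p)%E.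
  by apply: le_ereal_inf_tmp => _ [z [z0 _] <-]; rewrite lee_fin ltW.
have ty0 : (0 <= type_constant E p)%E.
  by apply: le_ereal_inf_tmp => _ [z [z0 _] <-]; rewrite lee_fin ltW.
have rhs0 : (0 <= slln_constant E q p k B * u%:E * v%:E)%E.
  rewrite !mule_ge0 ?lee_fin ?(ltW u0)// adde_ge0 ?lee_fin ?(ltW B0)//.
  by rewrite !mule_ge0// lee_fin mulr_ge0// ltW.
have [v_eq0|vn0] := eqVneq v 0.
  apply: le_trans rhs0; rewrite lee_fin.
  have := H M%:R (ler0n _ _) (@rademacher_bound_trivial R E M p q p0 q0).
  by rewrite v_eq0 !mulr0.
have {vn0 v0}v0 : 0 < v by rewrite lt_neqAle eq_sym vn0.
case tyE : (type_constant E p) ty0 => [t| |] // ty0; last first.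
  case: hE => tau [tau0 ty].
  have : (type_constant E p <= tau%:E)%E by apply: ereal_inf_lbound; exists tau.
  by rewrite tyE.
have [t0|tn0] := eqVneq t 0.
  apply: le_trans rhs0; rewrite lee_fin.
  have -> : 0 = 0 * (4 * k%:R * u * v) by rewrite mul0r.
  apply: H => // y.
  have x0 (x : E) : x = 0 by apply: (type_constant_eq0 x p0); rewrite tyE t0.
  rewrite -[leRHS](@sign_mean_cst R M); apply: ler_sign_mean => e.
  rewrite (x0 (\sum_j _)) normr0 powR0 ?gt_eqF// mul0r//.
have {tn0 ty0}t0 : 0 < t by rewrite lt_neqAle eq_sym tn0; rewrite lee_fin in ty0.
case kkE : (@kahane_khintchine R q p) kk0 => [K| |] // kk0; last first.
  rewrite /slln_constant kkE tyE.
  rewrite gt0_muley ?lte_fin ?mulr_gt0// gt0_mulye ?lte_fin//=.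
  by rewrite gt0_muley ?lte_fin// !gt0_mulye ?lte_fin// leey.
rewrite lee_fin in kk0.
rewrite /slln_constant kkE tyE.
have -> : (2%:E * ((2 * k%:R)%:E * K%:E * t%:E + B%:E) * u%:E * v%:E)%E =
  (2 * (2 * k%:R * K * t + B) * u * v)%:E by [].
rewrite lee_fin.
set c := 4 * k%:R * u * v in H.
have c0 : 0 < c by rewrite /c !mulr_gt0.
have : L <= K * (t * c).
  apply: (@le_ereal_inf_mulr
    [set K | 0 < K /\ kahane_khintchine_bound q p K]) kkE _ => //.
    by rewrite mulr_ge0 ?ltW.
  move=> K' [K'0 kb]; rewrite mulrCA.
  apply: (@le_ereal_inf_mulr [set tau | 0 < tau /\ type_bound E p tau]) tyE _ => //.
    by rewrite mulr_ge0 ?ltW.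
  move=> tau' [tau'0 tb]; rewrite mulrCA mulrA; apply: H.
    by rewrite mulr_ge0 ?ltW.
  exact: rademacher_bound_kahane_type.
move=> /le_trans; apply.
have -> : 2 * (2 * k%:R * K * t + B) * u * v = K * (t * c) + 2 * B * u * v.
  by rewrite /c; ring.
by rewrite lerDl !mulr_ge0 ?ltW.
Qed.

End Constants.

(** * Simple functions and Bochner expectations *)

Section SimpleFunctions.
Context {R : realType} {d : measure_display} {T : measurableType d}.
Variable P : probability T R.
Context {F : normedModType R}.

Lemma simple_function_preimage (s : T -> F) (B : set F) :
  simple_function s -> measurable (s @^-1` B).
Proof.
move=> [fs ms].
rewrite (_ : s @^-1` B = \bigcup_(y in range s `&` B) (s @^-1` [set y])).
  by apply: fin_bigcup_measurable => //; exact: finite_setIl.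
apply/seteqP; split=> [w Bw|w [y [_ By] /= ->]] //=.
by exists (s w) => //; split => //; exists w.
Qed.

Lemma simple_function_comp {A : finType} (g : T -> A) (h : A -> F) :
  (forall a, measurable (g @^-1` [set a])) -> simple_function (h \o g).
Proof.
move=> mg; split=> [|y].
  apply: (@sub_finite_set _ _ (h @` [set: A])).
    by move=> _ [w _ <-]; exists (g w).
  exact: finite_image.
by rewrite comp_preimage; exact: (measurable_preimage_fin mg).
Qed.

Lemma simple_function_factor (s : T -> F) : simple_function s ->
  exists N (g : T -> 'I_N) (h : 'I_N -> F),
    (forall a, measurable (g @^-1` [set a])) /\ s = h \o g.
Proof.
move=> ss; have [/finite_seqP[l lE] _] := ss.
have sl w : (index (s w) l < size l)%N.
  have : [set` l] (s w) by rewrite -lE; exists w.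
  by rewrite index_mem.
exists (size l), (fun w => Ordinal (sl w)), (fun i => nth 0 l i); split.
  move=> i; rewrite (_ : _ @^-1` _ = s @^-1` [set y | index y l = i]).
    exact: simple_function_preimage.
  by apply/seteqP; split=> w /= => [[<-]//|e]; exact/val_inj.
by apply/funext => w /=; rewrite nth_index// -index_mem.
Qed.

(** The values h a need not be distinct: grouping the a by their value gives
    the sum over the range. A value that is not attained comes from an empty
    fibre, of weight zero. *)
Lemma simple_expectation_comp {A : finType} (g : T -> A) (h : A -> F) :
  (forall a, measurable (g @^-1` [set a])) ->
  simple_expectation P (h \o g) = \sum_a law P g a *: h a.
Proof.
move=> mg; have [frng _] := simple_function_comp h mg.
rewrite /simple_expectation fsbig_finite//=.
have lawy y : fine (P ((h \o g) @^-1` [set y])) = \sum_(a | h a == y) law P g a.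
  have : (\int[P]_w (\1_[set a | h a = y] (g w))%:E =
     (\sum_a law P g a * \1_[set a | h a = y] a)%:E)%E.
    by apply: integral_finitely_valued.
  have -> : (\int[P]_w (\1_[set a | h a = y] (g w))%:E =
     \int[P]_w (\1_((h \o g) @^-1` [set y]) w)%:E)%E by [].
  rewrite integral_indic ?setIT//; last first.
    by rewrite comp_preimage; exact: (measurable_preimage_fin mg).
  move=> -> /=; rewrite [RHS]big_mkcond/=; apply: eq_bigr => a _.
  rewrite indicE; case: eqP => [ay|ay]; first by rewrite mem_set// mulr1.
  by rewrite memNset// mulr0.
transitivity (\sum_(y <- fset_set (range (h \o g))) \sum_a
    (if h a == y then law P g a *: h a else 0)).
  apply: eq_bigr => y _; rewrite lawy scaler_suml big_mkcond/=.
  by apply: eq_bigr => a _; case: eqP => // ->.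
rewrite exchange_big/=; apply: eq_bigr => a _.
rewrite -big_mkcond/=.
have [ha|ha] := boolP (h a \in fset_set (range (h \o g))).
  by rewrite (big_rem _ ha)/= eqxx big1_seq ?addr0// => y /andP[/eqP <-];
     rewrite mem_rem_uniqF// fset_uniq.
rewrite big1_seq; last by move=> y /andP[/eqP <-]; rewrite (negbTE ha).
suff -> : law P g a = 0 by rewrite scale0r.
rewrite /law (_ : g @^-1` [set a] = set0) ?measure0//.
apply/seteqP; split=> // w /= gw; move/negP: ha; apply.
by rewrite in_fset_set// mem_set//; exists w => //=; rewrite gw.
Qed.

(** The limit xi(w) is in the open set O exactly if, for some radius, the ball
    of that radius about s_n(w) is inside O for all large n. The sets that
    occur are preimages under simple functions, which are measurable for every
    subset of F; completeness of P absorbs the null set without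
    convergence. *)
Lemma bochner_measurable_preimage (xi : T -> F) (B : set F) :
  measure_is_complete P -> bochner_measurable P xi -> borel B ->
  measurable (xi @^-1` B).
Proof.
move=> cP [s [ss sxi]].
have opn O : open O -> measurable (xi @^-1` O).
  move=> oO.
  pose in_ball m := [set y : F | ball y (m.+1%:R^-1 : R) `<=` O].
  pose L := \bigcup_m \bigcup_N \bigcap_(n in [set n | (N <= n)%N])
     (s n @^-1` in_ball m).
  have mL : measurable L.
    apply: bigcup_measurable => m _; apply: bigcup_measurable => N _.
    by apply: bigcap_measurableType => n _; exact: simple_function_preimage.
  case: sxi => Z [mZ Z0 ZP].
  have key w : ~ Z w -> (L w <-> O (xi w)).
    move=> Zw; have cvg_w : s n w @[n --> \oo] --> xi w.
      by apply: contrapT => nc; apply: Zw; apply: ZP.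
    split.
      move=> [m _ [N _ LN]].
      have /cvgrPdist_lt/(_ (m.+1%:R^-1 : R)) := cvg_w.
      rewrite invr_gt0 ltr0n => /(_ isT)[N' _ HN'].
      apply: (LN (maxn N N')); first by rewrite /= leq_maxl.
      rewrite /= -ball_normE /=; rewrite distrC; apply: HN'; exact: leq_maxr.
    move=> Ow; have : nbhs (xi w) O by move: oO; rewrite openE => /(_ _ Ow).
    move=> /nbhs_ballP[e /= e0 eO].
    have e20 : 0 < e / 2 by rewrite divr_gt0.
    have [m mE] : exists m : nat, m.+1%:R^-1 < e / 2.
      have [m _ /(_ m (leqnn m)) me] := @near_infty_natSinv_lt R (PosNum e20).
      by exists m.
    have /cvgrPdist_lt/(_ _ e20)[N _ HN] := cvg_w.
    exists m => //; exists N => // n /= Nn y.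
    rewrite -ball_normE/= => yb; apply: eO; rewrite -ball_normE/=.
    rewrite -(subrKA (s n w)); apply: (le_lt_trans (ler_normD _ _)).
    rewrite (splitr e); apply: ltrD; first exact: HN.
    exact: lt_trans yb mE.
  rewrite (_ : xi @^-1` O = (L `\` Z) `|` (xi @^-1` O `&` Z)).
    apply: measurableU; first exact: measurableD.
    by apply: cP; exists Z; split => // w [].
  apply/seteqP; split=> w /=.
    have [Zw|Zw] := pselect (Z w); first by right.
    by left; split => //; apply/(key w Zw).
  by move=> [[Lw Zw]|[Ow _]]; first by apply/(key w Zw).
move=> bB; apply: (bB [set B | measurable (xi @^-1` B)]); split => //.
split.
- by rewrite /= preimage_set0.
- by move=> A mA; rewrite /= setTD preimage_setC; exact: measurableC.
- by move=> A mA; rewrite /= preimage_bigcup; apply: bigcup_measurable => i _; exact: mA.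
Qed.

Lemma bochner_measurable_norm (xi : T -> F) :
  measure_is_complete P -> bochner_measurable P xi ->
  measurable_fun setT (fun w => `|xi w|).
Proof.
move=> cP bxi.
apply: (measurability _ (RGenOInfty.measurableE R)) => // _ [_ [x ->] <-]; rewrite setTI.
rewrite (_ : _ @^-1` _ = xi @^-1` [set y | x < `|y|]).
  apply: bochner_measurable_preimage => //; apply: sub_sigma_algebra => /=.
  rewrite (_ : [set y | _] = (fun y : F => `|y|) @^-1` `]x, +oo[%classic).
    apply: open_comp; last exact: itv_open_ends_open.
    by move=> y _; exact: norm_continuous.
  by apply/seteqP; split=> y /=; rewrite in_itv/= andbT.
by apply/seteqP; split=> w /=; rewrite in_itv/= andbT.
Qed.

Lemma simple_functionB (s t : T -> F) :
  simple_function s -> simple_function t -> simple_function (fun w => s w - t w).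
Proof.
move=> /simple_function_factor[N [g [h [mg ->]]]].
move=> /simple_function_factor[N' [g' [h' [mg' ->]]]].
have mgg (a : 'I_N * 'I_N') : measurable ((fun w => (g w, g' w)) @^-1` [set a]).
  rewrite (_ : _ @^-1` _ = g @^-1` [set a.1] `&` g' @^-1` [set a.2]).
    exact: measurableI.
  by apply/seteqP; case: a => a b; split=> w /= [-> ->].
exact: (simple_function_comp (fun a => h a.1 - h' a.2) mgg).
Qed.

Lemma bochner_measurable_simple (s : T -> F) : simple_function s -> bochner_measurable P s.
Proof.
move=> ss; exists (fun=> s); split=> //.
by apply: nearW => w; exact: cvg_cst.
Qed.

Lemma bochner_measurableB (xi eta : T -> F) :
  bochner_measurable P xi -> bochner_measurable P eta ->
  bochner_measurable P (fun w => xi w - eta w).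
Proof.
move=> [s [ss sxi]] [t [st teta]]; exists (fun n w => s n w - t n w); split.
  by move=> n; exact: simple_functionB.
by apply: filterS2 sxi teta => w; exact: cvgB.
Qed.

Lemma simple_expectation_dist (s t : T -> F) :
  simple_function s -> simple_function t ->
  (`|simple_expectation P s - simple_expectation P t|%:E
     <= \int[P]_w (`|s w - t w|)%:E)%E.
Proof.
move=> /simple_function_factor[N [g [h [mg ->]]]].
move=> /simple_function_factor[N' [g' [h' [mg' ->]]]].
pose gg w := (g w, g' w).
have mgg a : measurable (gg @^-1` [set a]).
  rewrite (_ : _ @^-1` _ = g @^-1` [set a.1] `&` g' @^-1` [set a.2]).
    exact: measurableI.
  by apply/seteqP; case: a => a b; split=> w; rewrite /gg/= => -[-> ->].
rewrite (_ : h \o g = (fun a => h a.1) \o gg)// (_ : h' \o g' = (fun a => h' a.2) \o gg)//.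
rewrite !simple_expectation_comp// -sumrB.
rewrite (@integral_finitely_valued R d T P _ gg mgg (fun a => `|h a.1 - h' a.2|))// lee_fin.
apply: (le_trans (ler_norm_sum _ _ _)); apply: ler_sum => a _.
by rewrite -scalerBr normrZ ger0_norm// law_ge0.
Qed.

(** The integral over the distance to a common limit eta makes expectations of
    approximating sequences Cauchy, and any two of them asymptotic. *)
Lemma simple_expectation_dist_via (eta s t : T -> F) :
  measure_is_complete P -> bochner_measurable P eta ->
  simple_function s -> simple_function t ->
  (`|simple_expectation P s - simple_expectation P t|%:E <=
    \int[P]_w (`|eta w - s w|)%:E + \int[P]_w (`|eta w - t w|)%:E)%E.
Proof.
move=> cP beta ss st.
have mdist u : simple_function u -> measurable_fun setT (fun w => (`|eta w - u w|)%:E).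
  move=> su; apply/measurable_EFinP; apply: bochner_measurable_norm => //.
  by apply: bochner_measurableB => //; exact: bochner_measurable_simple.
apply: (le_trans (simple_expectation_dist ss st)).
rewrite -ge0_integralD//; [|exact: mdist|exact: mdist].
apply: ge0_le_integral => //.
- apply/measurable_EFinP; apply: bochner_measurable_norm => //.
  by apply: bochner_measurable_simple; exact: simple_functionB.
- by apply: emeasurable_funD; exact: mdist.
- move=> w _; rewrite -EFinD lee_fin.
  by rewrite -(subrKA (eta w)) (le_trans (ler_normD _ _))// lerD2r distrC.
Qed.

Lemma bochner_expectation_unique (eta : T -> F) (v v' : F) :
  measure_is_complete P ->
  is_bochner_expectation P eta v -> is_bochner_expectation P eta v' -> v = v'.
Proof.
move=> cP [s [ss s_eta s_int s_v]] [t [st t_eta t_int t_v]].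
have beta : bochner_measurable P eta by exists s.
have lim0 : (`|simple_expectation P (s n) - simple_expectation P (t n)|%:E
     @[n --> \oo] --> 0)%E.
  apply: (@squeeze_cvge _ _ _ _ (fun=> 0%E) _ (fun n =>
    (\int[P]_w (`|eta w - s n w|)%:E + \int[P]_w (`|eta w - t n w|)%:E)%E)).
  - by apply: nearW => n; rewrite lee_fin normr_ge0/= simple_expectation_dist_via.
  - exact: cvg_cst.
  - by rewrite -[X in _ --> X]adde0; exact: cvgeD.
have : `|simple_expectation P (s n) - simple_expectation P (t n)| @[n --> \oo] --> `|v - v'|.
  by apply: cvg_norm; exact: cvgB.
move=> lim1.
apply/eqP; rewrite -subr_eq0 -normr_eq0; apply/eqP.
have lim2 := @fine_cvg _ _ _ eventually_filter _ _ lim0.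
exact: (cvg_unique (@norm_hausdorff _ R) lim1 lim2).
Qed.

End SimpleFunctions.

(** * Discretization by nearest points *)

Section NearestPoint.
Context {R : realType} {E : normedModType R}.
Variable l : seq E.

(** The default 0 is put first among the points, so that the nearest point to
    x is at distance at most |x| from x. *)
Definition point_of (i : 'I_(size l).+1) : E := nth 0 (0 :: l) i.

(** Among the indices of nearest points, the choice depends only on the finite
    table of comparisons between distances, which makes it a Borel function of
    x. *)
Definition nearest (x : E) : 'I_(size l).+1 :=
  odflt ord0 [pick i | [forall j, `|x - point_of i| <= `|x - point_of j|]].

Lemma nearest_le (x : E) i : `|x - point_of (nearest x)| <= `|x - point_of i|.
Proof.
rewrite /nearest; case: pickP => [j /forallP/(_ i)//|no].
have [j _ jmin] := @arg_minP _ R 'I_(size l).+1 ord0 xpredT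
  (fun j => `|x - point_of j|) isT.
by have := no j; move/negbT/negP; case; apply/forallP => j'; exact: jmin.
Qed.

Lemma nearest_dist (x : E) : `|x - point_of (nearest x)| <= `|x|.
Proof. by have := nearest_le x ord0; rewrite {2}/point_of/= subr0. Qed.

Lemma norm_nearest (x : E) : `|point_of (nearest x)| <= 2 * `|x|.
Proof.
rewrite -[point_of _](subrK x) (le_trans (ler_normD _ _))// mulr_natl mulr2n.
by rewrite lerD2r distrC nearest_dist.
Qed.

(** The index depends only on which of the finitely many distances to the
    points are smaller, and strict comparison of two distances is an open
    condition. *)
Lemma nearest_borel a : borel (nearest @^-1` [set a]).
Proof.
pose X := g_sigma_algebraType [set U : set E | open U].
pose tab (x : X) : {ffun 'I_(size l).+1 * 'I_(size l).+1 -> bool} :=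
  [ffun ij => `|(x : E) - point_of ij.1| <= `|(x : E) - point_of ij.2|].
have lt_open i j : open [set x : E | `|x - point_of j| < `|x - point_of i|].
  rewrite (_ : [set x | _] = (fun x : E => `|x - point_of i| - `|x - point_of j|)
    @^-1` `]0, +oo[%classic); last first.
    by apply/seteqP; split=> x /=; rewrite in_itv/= andbT subr_gt0.
  apply: open_comp; last exact: itv_open_ends_open.
  move=> x _; apply: cvgB; apply: cvg_norm; apply: cvgB; first exact: cvg_id.
  - exact: cvg_cst.
  - exact: cvg_id.
  - exact: cvg_cst.
pose lt_set i j := [set x : X | `|(x : E) - point_of j| < `|(x : E) - point_of i|].
have mle i j b : measurable
    ([set x : X | (`|(x : E) - point_of i| <= `|(x : E) - point_of j|) = b]).
  have mlt : measurable (lt_set i j) by apply: sub_sigma_algebra; exact: lt_open.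
  case: b.
    rewrite (_ : [set x | _] = ~` lt_set i j); first exact: measurableC.
    by apply/seteqP; split=> x /=; rewrite /lt_set/= leNgt => /negP.
  rewrite (_ : [set x | _] = lt_set i j)//.
  by apply/seteqP; split=> x; rewrite /lt_set/= leNgt; [move=> /negbFE|move=> ->].
have mtab t : measurable (tab @^-1` [set t]).
  rewrite (_ : _ @^-1` _ = \bigcap_(ij in [set: 'I_(size l).+1 * 'I_(size l).+1])
    [set x : X | (`|(x : E) - point_of ij.1| <= `|(x : E) - point_of ij.2|) = t ij]).
    by apply: fin_bigcap_measurable => // ij _; exact: mle.
  apply/seteqP; split=> x /=.
    by move=> <- ij _ /=; rewrite ffunE.
  by move=> H; apply/ffunP => ij; rewrite ffunE H.
pose sel (t : {ffun 'I_(size l).+1 * 'I_(size l).+1 -> bool}) :=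
  odflt ord0 [pick i | [forall j, t (i, j)]].
have -> : nearest = sel \o tab.
  apply/funext => x; rewrite /sel /nearest/=; congr odflt; apply: eq_pick => i.
  by apply: eq_forallb => j; rewrite ffunE.
exact: (measurable_preimage_fin mtab (sel @^-1` [set a])).
Qed.

End NearestPoint.

Section Discretization.
Context {R : realType} {d : measure_display} {T : measurableType d}.
Variable P : probability T R.
Hypothesis cP : measure_is_complete P.
Context {E : normedModType R}.

Lemma measurable_nearest (xi : T -> E) (l : seq E) a :
  bochner_measurable P xi -> measurable ((nearest l \o xi) @^-1` [set a]).
Proof.
move=> bxi; rewrite comp_preimage; apply: (bochner_measurable_preimage cP bxi).
exact: nearest_borel.
Qed.

(** The points at stage n are the values of the n-th approximating simple
    functions of all the xi_j: the nearest point is at least as close to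
    xi_j(w) as the value of the approximating function at w. *)
Lemma exists_discretization (I : finType) (xi : I -> T -> E) :
  (forall j, bochner_measurable P (xi j)) ->
  exists l : nat -> seq E, forall j,
    {ae P, forall w, point_of (nearest (l n) (xi j w)) @[n --> \oo] --> xi j w}.
Proof.
move=> bxi; have [s sP] := choice bxi.
have /choice[l lP] n : exists l : seq E,
    [set` l] = \bigcup_(j in [set: I]) range (s j n).
  have : finite_set (\bigcup_(j in [set: I]) range (s j n)).
    by apply: bigcup_finite => // j _; exact: ((sP j).1 n).1.
  by move=> /finite_seqP[l ->]; exists l.
exists l => j; apply: filterS (sP j).2 => w sw.
apply/cvgrPdist_lt => e e0; move/cvgrPdist_lt : sw => /(_ e e0).
apply: filterS => n; apply: le_lt_trans.
have [i ->] : exists i : 'I_(size (l n)).+1, s j n w = point_of i.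
  have sl : s j n w \in l n.
    by have : [set` l n] (s j n w) by rewrite lP; exists j => //; exists w.
  have il : ((index (s j n w) (l n)).+1 < (size (l n)).+1)%N by rewrite ltnS index_mem.
  by exists (Ordinal il); rewrite /point_of/= nth_index.
exact: nearest_le.
Qed.

Context {G : completeNormedModType R}.

(** By [simple_expectation_dist_via] the expectations of the s_n are
    Cauchy. *)
Lemma bochner_expectation_exists (s : nat -> T -> G) (eta : T -> G) :
  (forall n, simple_function (s n)) ->
  {ae P, forall w, s n w @[n --> \oo] --> eta w} ->
  (\int[P]_w (`|eta w - s n w|)%:E)%E @[n --> \oo] --> 0%E ->
  exists v : G, simple_expectation P (s n) @[n --> \oo] --> v.
Proof.
move=> ss seta int0.
have beta : bochner_measurable P eta by exists s.
pose u : nat -> G := fun n => simple_expectation P (s n).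
suff : cauchy (u @ \oo).
  by move=> /cauchy_cvg c; exists (limn u).
apply: cauchy_exP => e e0.
have e20 : 0 < e / 2 by rewrite divr_gt0.
have [N _ HN] : \forall n \near \oo, (\int[P]_w (`|eta w - s n w|)%:E < (e / 2)%:E)%E.
  have /fine_cvgP[fin /cvgrPdist_lt/(_ _ e20)] := int0.
  apply: filterS2 fin => n fin; rewrite sub0r normrN/= => h.
  by rewrite -(fineK fin) lte_fin (le_lt_trans (ler_norm _)).
exists (simple_expectation P (s N)); exists N => // n Nn /=.
rewrite -ball_normE/= -lte_fin.
apply: (le_lt_trans (simple_expectation_dist_via cP beta (ss N) (ss n))).
by rewrite (splitr e) EFinD; apply: lteD; apply: HN => //=.
Qed.

End Discretization.

(** * Dominated convergence and Fatou's lemma for discretized variables *)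

Section Integrability.
Context {R : realType} {d : measure_display} {T : measurableType d}.
Variable P : probability T R.
Hypothesis cP : measure_is_complete P.

(** At a positive limit the power is differentiable; at the limit 0 the
    epsilon argument is direct. *)
Lemma cvg_powR (q x : R) (u : nat -> R) : 0 < q -> (forall n, 0 <= u n) ->
  u n @[n --> \oo] --> x -> u n `^ q @[n --> \oo] --> x `^ q.
Proof.
move=> q0 u0 ux.
have x0 : 0 <= x.
  by rewrite leNgt; apply/negP => x0; move/cvgrPdist_lt : ux => /(_ (- x));
    rewrite oppr_gt0 => /(_ x0)[N _ /(_ N (leqnn N))]/=;
    rewrite distrC ger0_norm ?subr_ge0 ?(le_trans (ltW x0))// gtrDr ltNge u0.
have [xE|xn0] := eqVneq x 0.
  rewrite xE powR0 ?gt_eqF//; rewrite xE in ux.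
  apply/cvgrPdist_lt => e e0.
  have ee : 0 < e `^ q^-1 by apply: powR_gt0.
  move/cvgrPdist_lt : ux => /(_ _ ee); apply: filterS => n.
  rewrite !sub0r !normrN !ger0_norm ?powR_ge0// => une.
  have -> : e = (e `^ q^-1) `^ q by rewrite -powRrM mulVf ?gt_eqF// powRr1// ltW.
  by apply: gt0_ltr_powR; rewrite ?nnegrE ?powR_ge0.
have {xn0}x0' : 0 < x by rewrite lt_neqAle eq_sym xn0.
apply: (@continuous_cvg _ _ _ _ _ _ (fun y : R => y `^ q)) => //.
apply: differentiable_continuous; apply/derivable1_diffP.
by apply: derivable_powR; rewrite in_itv/= x0'.
Qed.

Lemma measurable_norm_powR {F : normedModType R} (eta : T -> F) q :
  bochner_measurable P eta -> measurable_fun setT (fun w => (`|eta w| `^ q)%:E).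
Proof.
move=> beta; apply/measurable_EFinP.
apply: (measurableT_comp (f := fun x : R => x `^ q)); first exact: measurable_powR.
exact: (bochner_measurable_norm cP beta).
Qed.

Lemma le_limn_einf (u v : nat -> \bar R) :
  (forall n, u n <= v n)%E -> (limn_einf u <= limn_einf v)%E.
Proof.
move=> uv; rewrite !limn_einf_lim; apply: lee_lim; try exact: is_cvg_einfs.
apply: nearW => n; apply: le_ereal_inf_tmp => _ [m nm <-].
by apply: le_trans (uv m); apply: ereal_inf_lbound; exists m.
Qed.

Lemma limn_einf_cst0 : limn_einf (fun=> 0%E : \bar R) = 0%E.
Proof. by apply: (cvg_limn_einf_sup _).1; exact: cvg_cst. Qed.

(** The lower limit agrees almost everywhere with the power of the norm of the
    limit, hence is measurable by completeness of P. *)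
Lemma fatou_norm_powR {F : normedModType R} (q : R) (s : nat -> T -> F) (eta : T -> F)
    (u : nat -> \bar R) (c : \bar R) : 0 < q ->
  (forall n, simple_function (s n)) ->
  {ae P, forall w, s n w @[n --> \oo] --> eta w} ->
  (forall n, (\int[P]_w (`|s n w| `^ q)%:E <= u n)%E) ->
  u n @[n --> \oo] --> c ->
  (\int[P]_w (`|eta w| `^ q)%:E <= c)%E.
Proof.
move=> q0 ss seta su uc.
have beta : bochner_measurable P eta by exists s.
have ms n : measurable_fun setT (fun w => (`|s n w| `^ q)%:E).
  by apply: measurable_norm_powR; exact: bochner_measurable_simple.
have ae_lim : ae_eq P setT (fun w => (`|eta w| `^ q)%:E)
    (fun w => limn_einf (fun n => (`|s n w| `^ q)%:E)).
  apply: filterS seta => w sw _.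
  apply/esym; apply: (cvg_limn_einf_sup _).1.
  apply: cvg_EFin; first by apply: nearW.
  by apply: cvg_powR => //; exact: cvg_norm.
have mlim : measurable_fun setT (fun w => limn_einf (fun n => (`|s n w| `^ q)%:E)).
  by apply: (ae_measurable_fun cP ae_lim); exact: measurable_norm_powR.
have lim_ge0 w : (0 <= limn_einf (fun n => (`|s n w| `^ q)%:E))%E.
  by rewrite -limn_einf_cst0; apply: le_limn_einf => n; rewrite lee_fin powR_ge0.
rewrite (ge0_ae_eq_integral measurableT (measurable_norm_powR q beta) mlim _ _ ae_lim)//.
have [<- _] := cvg_limn_einf_sup uc.
apply: (le_trans (fatou P measurableT ms _)); last exact: le_limn_einf.
by move=> n w _; rewrite lee_fin powR_ge0.
Qed.

End Integrability.

Section Moments.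
Context {R : realType} {d : measure_display} {T : measurableType d}.
Variable P : probability T R.
Hypothesis cP : measure_is_complete P.
Context {E : normedModType R} (k : nat) (q : R).
Hypothesis q1 : 1 <= q.
Hypothesis k0 : (0 < k)%N.
Variables (xi : T -> E) (l : nat -> seq E).
Hypothesis bxi : bochner_measurable P xi.
Hypothesis xi_fin : (\int[P]_w ((`|xi w| ^+ k) `^ q)%:E < +oo)%E.
Hypothesis l_xi :
  {ae P, forall w, point_of (nearest (l n) (xi w)) @[n --> \oo] --> xi w}.

Let phi n w := point_of (nearest (l n) (xi w)).
Let Y w : R := (`|xi w| ^+ k) `^ q.

Lemma measurable_moment (eta : T -> E) : bochner_measurable P eta ->
  measurable_fun setT (fun w => ((`|eta w| ^+ k) `^ q)%:E).
Proof.
move=> beta; apply/measurable_EFinP.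
apply: (measurableT_comp (f := fun x : R => x `^ q)); first exact: measurable_powR.
apply: (measurableT_comp (f := fun x : R => x ^+ k)); first exact: exprn_measurable.
exact: (bochner_measurable_norm cP beta).
Qed.

Let integrable_dom (C : R) : P.-integrable setT (fun w => (C * (1 + Y w))%:E).
Proof.
have int1 : P.-integrable setT (fun=> 1%:E : \bar R).
  exact: (finite_measure_integrable_cst P 1).
have intY : P.-integrable setT (fun w => (Y w)%:E); last first.
  exact: (integrableZl measurableT C (integrableD measurableT int1 intY)).
apply/integrableP; split; first exact: measurable_moment.
under eq_integral => w _ do rewrite gee0_abs ?lee_fin ?powR_ge0//.
exact: xi_fin.
Qed.

Let pow_le_Y w : `|xi w| ^+ k <= 1 + Y w.
Proof.
rewrite /Y; set y := `|xi w| ^+ k.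
have y0 : 0 <= y by rewrite exprn_ge0.
have [y1|/ltW y1] := leP y 1.
  by rewrite (le_trans y1)// lerDl powR_ge0.
by rewrite (le_trans (le1r_powR y1 q1))// lerDr.
Qed.

Lemma simple_approx n : simple_function (phi n).
Proof.
exact: (@simple_function_comp _ _ _ E _ (nearest (l n) \o xi) (@point_of R E (l n))
  (fun a => measurable_nearest cP a bxi)).
Qed.

(** Dominated convergence: the nearest point has norm at most 2 |xi|. *)
Lemma moment_cvg : (\int[P]_w ((`|phi n w| ^+ k) `^ q)%:E)%E @[n --> \oo] -->
  (\int[P]_w ((`|xi w| ^+ k) `^ q)%:E)%E.
Proof.
have q0 : 0 < q by apply: lt_le_trans q1.
have bphi n : bochner_measurable P (phi n).
  by apply: bochner_measurable_simple; exact: simple_approx.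
pose C : R := (2 ^+ k) `^ q.
have [| | | | |_ _ //] := @dominated_convergence _ _ _ P setT measurableT
  (fun n w => ((`|phi n w| ^+ k) `^ q)%:E) (fun w => (Y w)%:E)
  (fun w => (C * (1 + Y w))%:E).
- by move=> n; exact: measurable_moment.
- exact: measurable_moment.
- apply: filterS l_xi => w cw _; apply: cvg_EFin; first by apply: nearW.
  apply: (@cvg_powR _ q _ (fun n => `|phi n w| ^+ k)) => //.
  by apply: (@continuous_cvg _ _ _ _ _ _ (fun y : R => y ^+ k));
    [exact: exprn_continuous|exact: cvg_norm].
- exact: integrable_dom.
- apply: nearW => w n _; rewrite gee0_abs ?lee_fin ?powR_ge0//.
  apply: (@le_trans _ _ (C * Y w)); last first.
    by rewrite ler_wpM2l ?powR_ge0// lerDr.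
  rewrite /C /Y -powRM ?exprn_ge0// -exprMn.
  apply: ge0_ler_powR; rewrite ?nnegrE ?exprn_ge0 ?mulr_ge0 ?(ltW q0)//.
  by apply: lerXn2r; rewrite ?nnegrE ?mulr_ge0//; exact: norm_nearest.
Qed.

Context {G : completeNormedModType R} (h : E -> G).
Hypothesis h_lip : forall x y rho, `|x| <= rho -> `|y| <= rho ->
  `|h x - h y| <= k%:R * rho ^+ k.-1 * `|x - y|.

Let h_approx w n :
  `|h (xi w) - h (phi n w)| <= k%:R * (2 * `|xi w|) ^+ k.-1 * `|xi w - phi n w|.
Proof.
apply: h_lip; last exact: norm_nearest.
by rewrite mulr_natl mulr2n lerDl.
Qed.

Lemma simple_image_approx n : simple_function (h \o phi n).
Proof.
exact: (@simple_function_comp _ _ _ G _ (nearest (l n) \o xi)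
  (h \o @point_of R E (l n)) (fun a => measurable_nearest cP a bxi)).
Qed.

Lemma image_approx_cvg :
  {ae P, forall w, (h \o phi n) w @[n --> \oo] --> (h \o xi) w}.
Proof.
apply: filterS l_xi => w cw; apply/cvgrPdist_lt => e e0.
set c := k%:R * (2 * `|xi w|) ^+ k.-1.
have c0 : 0 <= c by rewrite !mulr_ge0 ?exprn_ge0 ?mulr_ge0.
have c1 : 0 < c + 1 by rewrite ltr_wpDl.
have ec : 0 < e / (c + 1) by rewrite divr_gt0.
move/cvgrPdist_lt : cw => /(_ _ ec); apply: filterS => n hn.
apply: (le_lt_trans (h_approx w n)); rewrite -/c.
apply: (@le_lt_trans _ _ (c * (e / (c + 1)))).
  by rewrite ler_wpM2l// ltW.
by rewrite mulrCA gtr_pMr// ltr_pdivrMr// mul1r ltrDl.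
Qed.

(** Dominated convergence: the distance is at most k 2^(k-1) |xi|^k, and
    |xi|^k is at most 1 + |xi|^(kq). *)
Lemma image_approx_mean :
  (\int[P]_w (`|(h \o xi) w - (h \o phi n) w|)%:E)%E @[n --> \oo] --> 0%E.
Proof.
have bh : bochner_measurable P (h \o xi).
  by exists (fun n => h \o phi n); split;
    [exact: simple_image_approx|exact: image_approx_cvg].
pose C : R := k%:R * 2 ^+ k.-1.
have C0 : 0 <= C by rewrite mulr_ge0 ?exprn_ge0.
have [| | | | |_ _] := @dominated_convergence _ _ _ P setT measurableT
  (fun n w => (`|(h \o xi) w - (h \o phi n) w|)%:E) (fun=> 0%E)
  (fun w => (C * (1 + Y w))%:E); last by rewrite integral0.
- move=> n; apply/measurable_EFinP; apply: (bochner_measurable_norm cP).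
  apply: bochner_measurableB => //; apply: bochner_measurable_simple.
  exact: simple_image_approx.
- exact: measurable_cst.
- apply: filterS image_approx_cvg => w cw _; apply: cvg_EFin; first by apply: nearW.
  rewrite -(@normr0 R G) -(subrr (h (xi w))); apply: cvg_norm.
  by apply: cvgB => //; exact: cvg_cst.
- exact: integrable_dom.
- apply: nearW => w n _; rewrite gee0_abs ?lee_fin//.
  apply: (le_trans (h_approx w n)).
  apply: (@le_trans _ _ (C * (`|xi w| ^+ k))); last by rewrite ler_wpM2l.
  have -> : `|xi w| ^+ k = `|xi w| ^+ k.-1 * `|xi w| by rewrite -exprSr prednK.
  rewrite /C exprMn -!mulrA ler_wpM2l//.
  rewrite ler_wpM2l ?exprn_ge0// ler_wpM2l ?exprn_ge0//.
  exact: nearest_dist.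
Qed.

End Moments.

(** * The empirical moment and its limit *)

Section LqNorms.
Context {R : realType} {d : measure_display} {T : measurableType d}.
Variable P : probability T R.
Context {F : normedModType R}.

Lemma LqnormE (r : R) (eta : T -> F) :
  Lqnorm P r eta = ((\int[P]_w (`|eta w| `^ r)%:E) `^ r^-1)%E.
Proof.
rewrite /Lqnorm unlock/=; congr poweR.
by apply: eq_integral => w _; rewrite normr_id.
Qed.

Lemma Lqnorm_moment_lty (k : nat) (q : R) (eta : T -> F) : (0 < k)%N -> 0 < q ->
  (Lqnorm P (k%:R * q) eta < +oo)%E ->
  (\int[P]_w ((`|eta w| ^+ k) `^ q)%:E < +oo)%E.
Proof.
move=> k0 q0; rewrite LqnormE => /lty_poweRy.
rewrite invr_eq0 mulf_neq0 ?gt_eqF ?ltr0n//.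
move=> /(_ isT); congr (_ < _)%E; apply: eq_integral => w _.
by rewrite powRrM powR_mulrn.
Qed.

Lemma Lqnorm_moment (k : nat) (q : R) (eta : T -> F) : (0 < k)%N -> 0 < q ->
  (Lqnorm P (k%:R * q) eta < +oo)%E ->
  (Lqnorm P (k%:R * q) eta ^+ k =
   ((fine (\int[P]_w ((`|eta w| ^+ k) `^ q)%:E)) `^ q^-1)%:E)%E.
Proof.
move=> k0 q0 fin; have Jfin := Lqnorm_moment_lty k0 q0 fin.
rewrite LqnormE.
have -> : (\int[P]_w (`|eta w| `^ (k%:R * q))%:E =
   \int[P]_w ((`|eta w| ^+ k) `^ q)%:E)%E.
  by apply: eq_integral => w _; rewrite powRrM powR_mulrn.
have J0 : (0 <= \int[P]_w ((`|eta w| ^+ k) `^ q)%:E)%E.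
  by apply: integral_ge0 => w _; rewrite lee_fin powR_ge0.
set J := (\int[P]_w _)%E in J0 Jfin *.
have JE : J = (fine J)%:E by rewrite fineK// ge0_fin_numE.
rewrite {1}JE poweR_EFin -EFin_expe; congr EFin.
rewrite -powR_mulrn ?powR_ge0// -powRrM; congr (_ `^ _).
by field; rewrite !gt_eqF ?ltr0n.
Qed.

End LqNorms.

Section TensorOfSym.
Context {R : realType} {k : nat} {E : normedModType R}.

Lemma tensor_of_sym_sum {I : Type} (r : seq I) (c : I -> R) (U : I -> sym_tensor k E) :
  tensor_of_sym (\sum_(i <- r) c i *: U i) = \sum_(i <- r) c i *: tensor_of_sym (U i).
Proof.
elim: r => [|i r IH]; first by rewrite !big_nil; exact/val_inj.
by rewrite !big_cons -IH; exact/val_inj.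
Qed.

End TensorOfSym.

Section EmpiricalMoment.
Context {R : realType} {d : measure_display} {T : measurableType d}.
Variable P : probability T R.
Hypothesis cP : measure_is_complete P.
Context {E : normedModType R} {k M : nat} {S : completeNormedModType R}.
Context (iS : {linear sym_tensor k E -> S})
        (hS : is_completion (@sym_inj_norm R k E) iS).
Hypothesis k0 : (0 < k)%N.
Variables (xi : 'I_M -> T -> E) (i0 : 'I_M).
Hypothesis bxi : forall j, bochner_measurable P (xi j).
Hypothesis hind : independent P xi.
Hypothesis hid : identically_distributed P xi.

Section Discretized.
Variable l : seq E.

Let w := law P (nearest l \o xi i0).
Let g (om : T) : {ffun 'I_M -> 'I_(size l).+1} := [ffun j => nearest l (xi j om)].

Lemma sample_fiber (a : {ffun 'I_M -> 'I_(size l).+1}) :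
  g @^-1` [set a] =
  \big[setI/setT]_(j in [set: 'I_M]%SET) (xi j @^-1` (nearest l @^-1` [set a j])).
Proof.
rewrite -bigcap_seq_cond; apply/seteqP; split=> om /=.
  by move=> <- j _; rewrite /g ffunE.
move=> H; apply/ffunP => j; rewrite ffunE; apply: H.
by rewrite /= mem_index_enum finset.in_setT.
Qed.

Lemma measurable_sample (a : {ffun 'I_M -> 'I_(size l).+1}) :
  measurable (g @^-1` [set a]).
Proof.
rewrite sample_fiber; apply: bigsetI_measurable => j _.
exact: (measurable_nearest cP _ (bxi j)).
Qed.

(** The fibres of [nearest] are Borel sets, to which independence and equality
    of the laws apply. *)
Lemma sample_law a : law P g a = product_weight w a.
Proof.
apply: EFin_inj; rewrite lawE; last exact: measurable_sample.
rewrite sample_fiber hind; last by move=> j; exact: nearest_borel.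
rewrite /product_weight -prodEFin; apply: eq_big => [j|j _].
  by rewrite finset.in_setT.
rewrite /w lawE; last by move=> b; exact: (measurable_nearest cP _ (bxi i0)).
by rewrite comp_preimage; apply: hid; exact: nearest_borel.
Qed.

Lemma discretized_slln p q kappa : 1 <= p -> p <= q -> 0 <= kappa ->
  @rademacher_bound R E M p q kappa ->
  (\int[P]_om (`|\sum_c w c *: iS (sym_tpow k (point_of c)) -
      M%:R^-1 *: \sum_(j < M) iS (sym_tpow k (point_of (nearest l (xi j om))))| `^ q)%:E
   <= ((4 * k%:R * kappa * M%:R `^ (- (1 - p^-1))) `^ q)%:E *
      \int[P]_om ((`|point_of (nearest l (xi i0 om))| ^+ k) `^ q)%:E)%E.
Proof.
move=> p1 pq kappa0 hk.
have mw a : measurable ((nearest l \o xi i0) @^-1` [set a]).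
  exact: (measurable_nearest cP _ (bxi i0)).
have M0 : (0 < M)%N by apply: leq_ltn_trans (ltn_ord i0).
pose H (a : {ffun 'I_M -> 'I_(size l).+1}) :=
  `|\sum_c w c *: iS (sym_tpow k (point_of c)) -
      M%:R^-1 *: \sum_(j < M) iS (sym_tpow k (point_of (a j)))| `^ q.
rewrite (_ : (\int[P]_om _ = \int[P]_om (H (g om))%:E)%E); last first.
  apply: eq_integral => om _; rewrite /H; congr ((`|_ - _ *: _| `^ _)%:E).
  by apply: eq_bigr => j _; rewrite ffunE.
rewrite (@integral_finitely_valued R d T P _ g measurable_sample H); last first.
  by move=> a; exact: powR_ge0.
rewrite (integral_finitely_valued P mw (fun c => powR_ge0 (`|point_of c| ^+ k) q)).
rewrite -EFinM lee_fin.
under eq_bigr => a _ do rewrite sample_law.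
apply: (finite_slln hS k0 (@point_of R E l)) => //.
- by move=> c; exact: law_ge0.
- exact: law_sum1.
Qed.

End Discretized.
End EmpiricalMoment.

Theorem theorem3p16 (R : realType)
    (d : measure_display) (Omega : measurableType d)
    (P : probability Omega R) (hP : measure_is_complete P)
    (E : completeNormedModType R)
    (p : R) (hp1 : 1 <= p) (hp2 : p <= 2) (hE : rademacher_type E p)
    (q : R) (hpq : p <= q)
    (B : R) (hB0 : 0 < B) (hB : khintchine_bound q B)
    (k M : nat) (hk : (0 < k)%N) (hM : (0 < M)%N)
    (T : completeNormedModType R) (iT : {linear tensor k E -> T})
    (hT : is_completion (@inj_norm R k E) iT)
    (S : completeNormedModType R) (iS : {linear sym_tensor k E -> S})
    (hS : is_completion (@sym_inj_norm R k E) iS)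
    (xi : 'I_M -> Omega -> E)
    (hxi : forall j, in_Lq P (k%:R * q) (xi j))
    (hind : independent P xi) (hid : identically_distributed P xi) :
  let xi1 := xi (Ordinal hM) in
  exists m : S,
    sym_identified iT iS m (injective_moment iT P xi1) /\
    let err := fun w => m - M%:R^-1 *: \sum_(j < M) iS (sym_tpow k (xi j w)) in
    in_Lq P q err /\
    (Lqnorm P q err <=
       slln_constant E q p k B * (M%:R `^ (- (1 - p^-1)))%:E *
       Lqnorm P (k%:R * q) xi1 ^+ k)%E.
Proof.
move=> xi1; pose i0 := Ordinal hM.
have q1 : 1 <= q := le_trans hp1 hpq.
have q0 : 0 < q := lt_le_trans ltr01 q1.
have bxi j : bochner_measurable P (xi j) := (hxi j).1.
have norm_fin : (Lqnorm P (k%:R * q) xi1 < +oo)%E := (hxi i0).2.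
have mom_fin := Lqnorm_moment_lty hk q0 norm_fin.
have [l l_xi] := exists_discretization bxi.
pose h (x : E) : S := iS (sym_tpow k x).
pose hh (x : E) : T := iT (tpow k x).
have h_lip : forall x y rho, `|x| <= rho -> `|y| <= rho ->
    `|h x - h y| <= k%:R * rho ^+ k.-1 * `|x - y| := norm_sym_tpow_le hS.
have hT_lip : forall x y rho, `|x| <= rho -> `|y| <= rho ->
    `|hh x - hh y| <= k%:R * rho ^+ k.-1 * `|x - y| := norm_tpow_le hT.
pose phi n om := point_of (nearest (l n) (xi1 om)).
have sS n : simple_function (h \o phi n) := simple_image_approx hP l (bxi i0) h n.
have sT n : simple_function (hh \o phi n) := simple_image_approx hP l (bxi i0) hh n.
have cS := image_approx_cvg (l_xi i0) h_lip.
have cT := image_approx_cvg (l_xi i0) hT_lip.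
have iSm := image_approx_mean hP q1 hk (bxi i0) mom_fin (l_xi i0) h_lip.
have iTm := image_approx_mean hP q1 hk (bxi i0) mom_fin (l_xi i0) hT_lip.
have [m m_lim] := bochner_expectation_exists hP sS cS iSm.
have [v v_lim] := bochner_expectation_exists hP sT cT iTm.
pose w n := law P (nearest (l n) \o xi i0).
have mw n a : measurable ((nearest (l n) \o xi i0) @^-1` [set a]).
  exact: (measurable_nearest hP _ (bxi i0)).
have expS n : simple_expectation P (h \o phi n) = \sum_c w n c *: h (point_of c).
  exact: (simple_expectation_comp P (h \o @point_of R E (l n)) (mw n)).
have expT n : simple_expectation P (hh \o phi n) = \sum_c w n c *: hh (point_of c).
  exact: (simple_expectation_comp P (hh \o @point_of R E (l n)) (mw n)).
(* the means of the discretized powers are the images, in S and in T, of the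
   same symmetric tensors *)
exists m; split.
  exists (fun n => \sum_c w n c *: sym_tpow k (point_of c)); split.
    apply: cvg_trans m_lim; apply: near_eq_cvg; apply: nearW => n.
    by rewrite expS linear_sum; apply: eq_bigr => c _; rewrite linearZ.
  have -> : injective_moment iT P xi1 = v.
    have bv : is_bochner_expectation P (fun om => iT (tpow k (xi1 om))) v.
      by exists (fun n => hh \o phi n).
    apply: (bochner_expectation_unique hP _ bv).
    by apply: xgetPex; exists v.
  apply: cvg_trans v_lim; apply: near_eq_cvg; apply: nearW => n.
  rewrite expT tensor_of_sym_sum linear_sum; apply: eq_bigr => c _.
  by rewrite linearZ.
move=> err.
pose err_n n om := \sum_c w n c *: h (point_of c) -
  M%:R^-1 *: \sum_(j < M) h (point_of (nearest (l n) (xi j om))).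
have s_err n : simple_function (err_n n).
  pose f (a : {ffun 'I_M -> 'I_(size (l n)).+1}) := \sum_c w n c *: h (point_of c) -
    M%:R^-1 *: \sum_(j < M) h (point_of (a j)).
  have := simple_function_comp f (measurable_sample hP bxi (l := l n)).
  congr simple_function; apply/funext => om; rewrite /= /f /err_n.
  by congr (_ - _ *: _); apply: eq_bigr => j _; rewrite ffunE.
have c_err : {ae P, forall om, err_n n om @[n --> \oo] --> err om}.
  have all_cvg : {ae P, forall om, forall j : 'I_M,
      h (point_of (nearest (l n) (xi j om))) @[n --> \oo] --> h (xi j om)}.
    by apply: filter_forall => j; exact: (image_approx_cvg (l_xi j) h_lip).
  apply: filterS all_cvg => om c_om; apply: cvgB.
    by apply: cvg_trans m_lim; apply: near_eq_cvg; apply: nearW => n; rewrite expS.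
  apply: cvgZr; apply: cvg_big => [|j _]; last exact: c_om.
  exact: add_continuous.
set J := (\int[P]_om ((`|xi1 om| ^+ k) `^ q)%:E)%E in mom_fin.
have J0 : (0 <= J)%E by apply: integral_ge0 => om _; rewrite lee_fin powR_ge0.
have JE : J = (fine J)%:E by rewrite fineK// ge0_fin_numE.
have j0 : 0 <= fine J by rewrite fine_ge0.
set u := M%:R `^ (- (1 - p^-1)).
have u0 : 0 < u by apply: powR_gt0; rewrite ltr0n.
have err_bound kappa : 0 <= kappa -> @rademacher_bound R E M p q kappa ->
    (\int[P]_om (`|err om| `^ q)%:E <= ((4 * k%:R * kappa * u) `^ q * fine J)%:E)%E.
  move=> kappa0 hkappa; rewrite EFinM -JE.
  apply: (@fatou_norm_powR _ _ _ P hP S q err_n err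
    (fun n => ((4 * k%:R * kappa * u) `^ q)%:E *
       \int[P]_om ((`|point_of (nearest (l n) (xi i0 om))| ^+ k) `^ q)%:E)%E) => //.
    by move=> n; exact: (discretized_slln hP hS hk i0).
  apply: cvgeZl => //.
  exact: (moment_cvg hP q1 (bxi i0) mom_fin (l_xi i0)).
have norm_bound kappa : 0 <= kappa -> @rademacher_bound R E M p q kappa ->
    (Lqnorm P q err <= (kappa * (4 * k%:R * u * (fine J) `^ q^-1))%:E)%E.
  move=> kappa0 hkappa; rewrite LqnormE.
  have c0 : 0 <= 4 * k%:R * kappa * u by rewrite !mulr_ge0// ltW.
  apply: (@le_trans _ _ ((((4 * k%:R * kappa * u) `^ q * fine J)%:E `^ q^-1)%E)).
    apply: gt0_ler_poweR; rewrite ?invr_ge0 ?(ltW q0)//; last exact: err_bound.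
    - by rewrite in_itv/= leey andbT integral_ge0// => om _; rewrite lee_fin powR_ge0.
    - by rewrite in_itv/= leey andbT lee_fin mulr_ge0// powR_ge0.
  rewrite poweR_EFin lee_fin powRM ?powR_ge0// -powRrM mulfV ?gt_eqF// powRr1//.
  by rewrite le_eqVlt; apply/orP; left; apply/eqP; ring.
have p0 : 0 < p by exact: lt_le_trans hp1.
(* kappa = M is admissible for every E, so this bound is finite *)
have norm_lty : (Lqnorm P q err < +oo)%E.
  apply: (le_lt_trans (norm_bound M%:R (ler0n _ _) _)); last exact: ltry.
  exact: rademacher_bound_trivial.
split; first by split=> //; exists err_n.
rewrite (Lqnorm_moment hk q0 norm_fin) -/J.
have nE : Lqnorm P q err = (fine (Lqnorm P q err))%:E.
  by rewrite fineK// ge0_fin_numE// Lnorm_ge0.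
rewrite nE; apply: slln_constant_bound => //; first exact: powR_ge0.
by move=> kappa kappa0 hkappa; rewrite -lee_fin -nE; exact: norm_bound.
Qed.
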